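(* Let $r$ be an odd prime, $\ell \geq 1$ an integer, and $\mathbb{F}$ a field containing a primitive $r$th root of unity $\theta$. Let $W$ be the $r^\ell$-dimensional $\mathbb{F}$-vector space with the linear maps $C_t, D_{st}, U_t$ and the scalar $\lambda$ defined in the context, and let $G$ be the subgroup of $\operatorname{GL}(W)$ generated by $\lambda C_t$ ($1 \leq t \leq \ell$), $D_{st}$ ($1 \leq s < t \leq \ell$), and $U_t$ ($1 \leq t \leq \ell$). Then $G \cong \operatorname{Sp}_{2\ell}(r)$, with an isomorphism given by the restriction to $G$ of the map $\pi: N_{\operatorname{GL}(W)}(R) \rightarrow \operatorname{Sp}_{2\ell}(r)$ defined in the context.
   Context: $W$ has a basis of vectors $v_{\xi_1, \ldots, \xi_\ell}$, $0 \leq \xi_1, \ldots, \xi_\ell < r$, with indices interpreted modulo $r$. For $1 \leq t \leq \ell$ and $1 \leq s < t \leq \ell$, define linear maps $W \to W$ by $$A_t v_{\xi_1, \ldots, \xi_\ell} = \theta^{\xi_t} v_{\xi_1, \ldots, \xi_\ell},\qquad B_t v_{\xi_1, \ldots, \xi_\ell} = v_{\xi_1, \ldots, \xi_{t-1}, \xi_t+1, \xi_{t+1}, \ldots, \xi_\ell},$$ $$C_t v_{\xi_1, \ldots, \xi_\ell} = \sum_{0 \leq i < r} \theta^{i \xi_t} v_{\xi_1, \ldots, \xi_{t-1}, i, \xi_{t+1}, \ldots, \xi_\ell},\qquad D_{st} v_{\xi_1, \ldots, \xi_\ell} = \theta^{\xi_s \xi_t} v_{\xi_1, \ldots, \xi_\ell},$$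 $$U_t v_{\xi_1, \ldots, \xi_\ell} = \theta^{\frac{\xi_t(\xi_t+r)}{2}} v_{\xi_1, \ldots, \xi_\ell}.$$ All of these maps are invertible. Let $C$ be the invertible linear map on an $r$-dimensional $\mathbb{F}$-space $V$ with basis $v_0, \ldots, v_{r-1}$ given by $C v_\xi = \sum_{0 \leq i < r} \theta^{i\xi} v_i$, and set $\lambda = (-r)^{(r-1)/2} \det(C)^{-1} \in \mathbb{F}^\times$. Let $R = \langle A_t, B_t : 1 \leq t \leq \ell \rangle \leq \operatorname{GL}(W)$. This is an extraspecial $r$-group of order $r^{1+2\ell}$ and exponent $r$, with $Z(R) = \langle \theta I_W \rangle$. The quotient $R/Z(R)$ is regarded as a $2\ell$-dimensional vector space over $\mathbb{F}_r$, and the group commutator induces a non-degenerate alternating bilinear form $b$ on it, determined by $[x,y] = \theta^{b(xZ(R), yZ(R))} I_W$ for $x,y \in R$. $\operatorname{Sp}_{2\ell}(r)$ denotes the group of isometries of $b$ on $R/Z(R)$. The homomorphism $\pi: N_{\operatorname{GL}(W)}(R) \rightarrow \operatorname{Sp}_{2\ell}(r)$ sends $g$ to the action of $g$ on $R/Z(R)$ by conjugation, $xZ(R) \mapsto gxg^{-1}Z(R)$. The maps $A_t, B_t, C_t, D_{st}, U_t$ all normalize $R$. *)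

(* Defs.v *)
From HB Require Import structures.
From mathcomp Require Import all_boot all_order all_algebra.
From mathcomp Require Import boolp.
Import GRing.Theory.

Set Implicit Arguments.
Unset Strict Implicit.
Unset Printing Implicit Defensive.

Local Open Scope ring_scope.

Section Subgroups.

Variable gT : groupType.
Implicit Types (S : {pred gT}) (H : groupClosed gT).

Definition subg_type H := {x : gT | x \in H}.

Definition generated S : {pred gT} :=
  fun x => `[< forall H, {subset S <= H} -> x \in H >].

Lemma generatedP S x :
  reflect (forall H, {subset S <= H} -> x \in H) (x \in generated S).
Proof. exact: asboolP. Qed.

Fact generated_mulg S : mulg_closed (generated S).
Proof.
move=> x y /generatedP Sx /generatedP Sy; apply/generatedP => H sSH.
by rewrite gpredM ?Sx ?Sy.
Qed.

Fact generated_one S : 1%g \in generated S.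
Proof. by apply/generatedP => H _; apply: gpred1. Qed.

Fact generated_invg S : invg_closed (generated S).
Proof.
by move=> x /generatedP Sx; apply/generatedP => H sSH; rewrite gpredV Sx.
Qed.

HB.instance Definition _ S :=
  isMulClosed.Build gT (generated S) (@generated_mulg S).
HB.instance Definition _ S :=
  isMul1Closed.Build gT (generated S) (@generated_one S).
HB.instance Definition _ S :=
  isInvClosed.Build gT (generated S) (@generated_invg S).

Lemma mem_generated S : {subset S <= generated S}.
Proof. by move=> x Sx; apply/generatedP => H; apply. Qed.

Definition normaliser S : {pred gT} :=
  fun g => `[< forall x, (g * x * g^-1 \in S)%g = (x \in S) >].

Lemma normaliserP S g :
  reflect (forall x, (g * x * g^-1 \in S)%g = (x \in S)) (g \in normaliser S).
Proof. exact: asboolP. Qed.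

Fact normaliser_mulg S : mulg_closed (normaliser S).
Proof.
move=> g h /normaliserP Ng /normaliserP Nh; apply/normaliserP => x.
by rewrite invgM -(Nh x) -(Ng (h * x * h^-1)%g) !mulgA.
Qed.

Fact normaliser_one S : 1%g \in normaliser S.
Proof. by apply/normaliserP => x; rewrite invg1 mul1g mulg1. Qed.

Fact normaliser_invg S : invg_closed (normaliser S).
Proof.
move=> g /normaliserP Ng; apply/normaliserP => x.
by rewrite -Ng invgK !mulgA mulgV mul1g mulgK.
Qed.

HB.instance Definition _ S :=
  isMulClosed.Build gT (normaliser S) (@normaliser_mulg S).
HB.instance Definition _ S :=
  isMul1Closed.Build gT (normaliser S) (@normaliser_one S).
HB.instance Definition _ S :=
  isInvClosed.Build gT (normaliser S) (@normaliser_invg S).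

End Subgroups.

Section SubgroupType.

Variables (gT : groupType) (H : groupClosed gT).

Fact subg_closed : group_closed (H : {pred gT}).
Proof. by split; [apply: gpred1 | move=> x y; apply: gpredF]. Qed.

HB.instance Definition _ := SubChoice.on (subg_type H).
HB.instance Definition _ :=
  SubChoice_isSubGroup.Build gT _ (subg_type H) subg_closed.

End SubgroupType.

Section CentralQuotient.

Variable gT : groupType.
Implicit Types x y z : gT.

Definition centre : {pred gT} := fun x => `[< forall y, commute x y >].

Lemma centreP x : reflect (forall y, commute x y) (x \in centre).
Proof. exact: asboolP. Qed.

Definition same_coset x y := (x^-1 * y)%g \in centre.

Fact same_coset_refl : reflexive same_coset.
Proof.
move=> x; rewrite /same_coset mulVg; apply/centreP => y.
exact/commute_sym/commute1.
Qed.

Fact same_coset_sym : symmetric same_coset.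
Proof.
suff sym x y : same_coset x y -> same_coset y x.
  by move=> x y; apply/idP/idP; apply: sym.
rewrite /same_coset => /centreP c; apply/centreP => z.
have -> : (y^-1 * x = (x^-1 * y)^-1)%g by rewrite invgM invgK.
by apply/commute_sym/commuteV/commute_sym.
Qed.

Fact same_coset_trans : transitive same_coset.
Proof.
rewrite /same_coset => y x z /centreP c /centreP d; apply/centreP => w.
have -> : (x^-1 * z = (x^-1 * y) * (y^-1 * z))%g by rewrite -mulgA mulVKg.
by apply/commute_sym/commuteM; apply/commute_sym.
Qed.

Canonical same_coset_equiv :=
  EquivRel same_coset same_coset_refl same_coset_sym same_coset_trans.

Definition central_quotient := {eq_quot same_coset}%qT.

End CentralQuotient.

Section GeneralLinearGroup.

Variables (F : fieldType) (vT : vectType F).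

Record GL := MkGL { GL_lfun :> 'End(vT); GL_lker0 : lker GL_lfun == 0%VS }.

HB.instance Definition _ := [isSub for GL_lfun].
HB.instance Definition _ := [Choice of GL by <:].

Fact GL_one_lker0 : lker (\1%VF : 'End(vT)) == 0%VS.
Proof. by apply/lker0P => u v; rewrite !id_lfunE. Qed.

Fact GL_mul_lker0 (f g : GL) : lker (f \o g)%VF == 0%VS.
Proof.
apply/lker0P => u v; rewrite !comp_lfunE.
by move/(lker0P (GL_lker0 f))/(lker0P (GL_lker0 g)).
Qed.

Fact GL_inv_lker0 (f : GL) : lker (f^-1)%VF == 0%VS.
Proof. by apply/lker0P/(can_inj (lker0_lfunVK (GL_lker0 f))). Qed.

Definition GL_one := MkGL GL_one_lker0.
Definition GL_mul f g := MkGL (GL_mul_lker0 f g).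
Definition GL_inv f := MkGL (GL_inv_lker0 f).

Fact GL_mulA : associative GL_mul.
Proof. by move=> f g h; apply/val_inj; rewrite /= comp_lfunA. Qed.
Fact GL_mul1 : left_id GL_one GL_mul.
Proof. by move=> f; apply/val_inj; rewrite /= comp_lfun1l. Qed.
Fact GL_mulr1 : right_id GL_one GL_mul.
Proof. by move=> f; apply/val_inj; rewrite /= comp_lfun1r. Qed.
Fact GL_mulV : left_inverse GL_one GL_inv GL_mul.
Proof. by move=> f; apply/val_inj; rewrite /= lker0_compVf ?GL_lker0. Qed.
Fact GL_mulrV : right_inverse GL_one GL_inv GL_mul.
Proof. by move=> f; apply/val_inj; rewrite /= lker0_compfV ?GL_lker0. Qed.

HB.instance Definition _ :=
  isGroup.Build GL GL_mulA GL_mul1 GL_mulr1 GL_mulV GL_mulrV.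

Lemma GLM (f g : GL) u : (f * g)%g u = f (g u).
Proof. exact: comp_lfunE. Qed.

Lemma GL1 u : (1%g : GL) u = u.
Proof. exact: id_lfunE. Qed.

Lemma GLP (f g : GL) : f =1 g -> f = g.
Proof. by move=> fg; apply/val_inj/lfunP. Qed.

Variable b : vT -> vT -> F.

Definition isometries : {pred GL} :=
  fun g => `[< forall u v, b (g u) (g v) = b u v >].

Lemma isometriesP (g : GL) :
  reflect (forall u v, b (g u) (g v) = b u v) (g \in isometries).
Proof. exact: asboolP. Qed.

Fact isometries_mulg : mulg_closed isometries.
Proof.
move=> g h /isometriesP bg /isometriesP bh; apply/isometriesP => u v.
by rewrite !GLM bg bh.
Qed.

Fact isometries_one : 1%g \in isometries.
Proof. by apply/isometriesP => u v; rewrite !GL1. Qed.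

Fact isometries_invg : invg_closed isometries.
Proof.
move=> g /isometriesP bg; apply/isometriesP => u v.
by rewrite -bg -!GLM mulgV !GL1.
Qed.

HB.instance Definition _ := isMulClosed.Build GL isometries isometries_mulg.
HB.instance Definition _ := isMul1Closed.Build GL isometries isometries_one.
HB.instance Definition _ := isInvClosed.Build GL isometries isometries_invg.

End GeneralLinearGroup.

Lemma generated_ind (gT : groupType) (S : {pred gT}) (P : gT -> Prop) :
    {in S, forall x, P x} -> P 1%g ->
    (forall x y, P x -> P y -> P (x * y)%g) -> (forall x, P x -> P x^-1%g) ->
  {in generated S, forall x, P x}.
Proof.
move=> PS P1 PM PV x /generatedP gSx; pose H : {pred gT} := fun x => `[< P x >].
have HM : mulg_closed H.
  by move=> y z /asboolP Py /asboolP Pz; apply/asboolP/PM.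
have HV : invg_closed H by move=> y /asboolP Py; apply/asboolP/PV.
have H1 : 1%g \in H by apply/asboolP.
pose H' : groupClosed gT := HB.pack H (isMulClosed.Build gT H HM)
  (isMul1Closed.Build gT H H1) (isInvClosed.Build gT H HV).
by apply/asboolP/(gSx H') => y Sy; apply/asboolP/PS.
Qed.

Section Space.

Variables (F : fieldType) (r l : nat).

Definition label := {ffun 'I_l -> 'I_r}.

Definition W := {ffun label -> F^o}.
HB.instance Definition _ := Vector.on W.

Definition basis_vec (xi : label) : W := [ffun eta => (eta == xi)%:R].

Definition replace (xi : label) (t : 'I_l) (i : 'I_r) : label :=
  [ffun s => if s == t then i else xi s].

Definition lin_ext (f : label -> W) (w : W) : W :=
  \sum_(xi : label) (w xi : F) *: f xi.

Fact lin_ext_is_linear f : linear (lin_ext f).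
Proof.
move=> a u v; rewrite /lin_ext scaler_sumr -big_split /=.
by apply: eq_bigr => xi _; rewrite !ffunE scalerDl scalerA.
Qed.

HB.instance Definition _ f :=
  GRing.isLinear.Build F W W _ (lin_ext f) (lin_ext_is_linear f).

(* The endomorphism of W with prescribed images of the basis vectors *)
Definition endo (f : label -> W) : 'End(W) := linfun (lin_ext f).

Lemma endoE f xi : endo f (basis_vec xi) = f xi.
Proof.
rewrite lfunE /= /lin_ext (bigD1 xi) //= big1 ?addr0 => [|eta].
  by rewrite ffunE eqxx scale1r.
by rewrite ffunE => /negPf->; rewrite scale0r.
Qed.

Lemma basis_sum (w : W) : w = \sum_xi (w xi : F) *: basis_vec xi.
Proof.
apply/ffunP => xi; rewrite sum_ffunE (bigD1 xi) //= big1 ?addr0 => [|eta].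
  by rewrite !ffunE eqxx [RHS]mulr1.
by rewrite eq_sym !ffunE => /negPf->; rewrite [LHS]mulr0.
Qed.

Lemma basisP (f g : 'End(W)) :
  (forall xi, f (basis_vec xi) = g (basis_vec xi)) -> f =1 g.
Proof.
move=> fg w; rewrite (basis_sum w) !linear_sum.
by apply: eq_bigr => xi _; rewrite !linearZ /= fg.
Qed.

Lemma endo_lker0 (f g : 'End(W)) (c : F) : c != 0 ->
  (forall xi, g (f (basis_vec xi)) = c *: basis_vec xi) -> lker f == 0%VS.
Proof.
move=> c0 gf; apply/lker0P/(@can_inj _ _ _ (fun w => c^-1 *: g w)) => w.
have -> : g (f w) = c *: w.
  rewrite {1}(basis_sum w) [in RHS](basis_sum w) !linear_sum /=.
  by apply: eq_bigr => xi _; rewrite !linearZ /= gf !scalerA mulrC.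
by rewrite scalerA mulVf ?scale1r.
Qed.

End Space.

Arguments basis_vec {F r l}.
Arguments W : clear implicits.

Section Operators.

Variables (F : fieldType) (r l : nat) (theta : F).
Implicit Types (s t : 'I_l).

Local Notation W := (W F r l).
Local Notation idx := (label r l).

Definition opA t : 'End(W) :=
  endo (fun xi : idx => theta ^+ xi t *: basis_vec xi).

Definition opB t : 'End(W) :=
  endo (fun xi : idx => basis_vec (replace xi t (ordS (xi t)))).

Definition opC t : 'End(W) :=
  endo (fun xi : idx =>
    \sum_(i < r) theta ^+ (i * xi t)%N *: basis_vec (replace xi t i)).

Definition opD s t : 'End(W) :=
  endo (fun xi : idx => theta ^+ (xi s * xi t)%N *: basis_vec xi).

(* For r odd, xi t * (xi t + r) is even, so the halving is exact. *)
Definition opU t : 'End(W) :=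
  endo (fun xi : idx => theta ^+ (xi t * (xi t + r))./2 *: basis_vec xi).

Definition mxC : 'M[F]_r := \matrix_(i, xi) theta ^+ (i * xi)%N.

(* For r odd, r.-1 is even, so the halving is exact. *)
Definition lambda : F := (- r%:R) ^+ (r.-1)./2 * (\det mxC)^-1.

Hypothesis theta_prim : r.-primitive_root theta.

Let theta_r : theta ^+ r = 1. Proof. exact: prim_expr_order. Qed.

Lemma theta_neq0 : theta != 0.
Proof.
apply/eqP => t0; have := theta_r; rewrite t0 expr0n.
by rewrite -[r == _]negbK -lt0n (prim_order_gt0 theta_prim) => /esym/eqP; rewrite oner_eq0.
Qed.

Lemma diag_lker0 (e : idx -> nat) :
  lker (endo (fun xi => theta ^+ e xi *: basis_vec xi) : 'End(W)) == 0%VS.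
Proof.
apply: (@endo_lker0 _ _ _ _ (endo (fun xi => theta ^- e xi *: basis_vec xi)) 1).
  exact: oner_neq0.
move=> xi; rewrite endoE linearZ /= endoE scalerA mulfV ?expf_neq0 ?theta_neq0 //.
Qed.

Lemma replaceK (xi : idx) t i : replace (replace xi t i) t (xi t) = xi.
Proof. by apply/ffunP => s; rewrite !ffunE; case: eqP => // ->. Qed.

Lemma replace_replace (xi : idx) t i j :
  replace (replace xi t i) t j = replace xi t j.
Proof. by apply/ffunP => s; rewrite !ffunE; case: eqP. Qed.

Lemma replaceE (xi : idx) t i : replace xi t i t = i.
Proof. by rewrite ffunE eqxx. Qed.

Lemma replace_id (xi : idx) t : replace xi t (xi t) = xi.
Proof. by apply/ffunP => s; rewrite !ffunE; case: eqP => // ->. Qed.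

Lemma opA_lker0 t : lker (opA t) == 0%VS.
Proof. exact: diag_lker0. Qed.

Lemma opD_lker0 s t : lker (opD s t) == 0%VS.
Proof. exact: diag_lker0. Qed.

Lemma opU_lker0 t : lker (opU t) == 0%VS.
Proof. exact: diag_lker0. Qed.

Lemma opB_lker0 t : lker (opB t) == 0%VS.
Proof.
apply: (@endo_lker0 _ _ _ _
  (endo (fun xi : idx => basis_vec (replace xi t (ord_pred (xi t))))) 1).
  exact: oner_neq0.
by move=> xi; rewrite !endoE replaceE ordSK replaceK scale1r.
Qed.

Lemma theta_sum (i j : 'I_r) :
  \sum_(k < r) theta ^+ (k * i)%N * theta ^- (k * j)%N = r%:R *+ (i == j).
Proof.
have th0 k : theta ^+ k != 0 by rewrite expf_neq0 ?theta_neq0.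
case: eqP => [<-|/eqP neq_ij].
  under eq_bigr => k _ do rewrite mulfV //.
  by rewrite sumr_const card_ord.
pose z := theta ^+ i / theta ^+ j; rewrite mulr0n.
have zr : z ^+ r = 1 by rewrite expr_div_n -!exprM ![(_ * r)%N]mulnC !exprM theta_r !expr1n divr1.
have z1 : 1 - z != 0.
  rewrite subr_eq0 eq_sym; apply: contra neq_ij => /eqP z1.
  have /eqP : theta ^+ i = theta ^+ j by rewrite -[RHS]mul1r -z1 divfK.
  by rewrite (eq_prim_root_expr theta_prim) !modn_small.
have : 1 ^+ r - z ^+ r = 0 by rewrite zr expr1n subrr.
rewrite subrXX => z_sum; apply: (mulfI z1); rewrite mulr0 -[RHS]z_sum.
congr (_ * _); apply: eq_bigr => k _.
by rewrite expr1n mul1r expr_div_n -!exprM ![(_ * k)%N]mulnC.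
Qed.

Lemma mxC_unit : mxC \in unitmx.
Proof.
pose D : 'M[F]_r := \matrix_(i, j) (theta ^- (j * i)%N).
have DC : D *m mxC = (r%:R)%:M.
  apply/matrixP => j i; rewrite !mxE eq_sym -theta_sum.
  by apply: eq_bigr => k _; rewrite !mxE mulrC.
have := congr1 determinant DC; rewrite det_mulmx det_scalar unitmxE unitfE => e.
apply/eqP => d0; move/eqP: e; rewrite d0 mulr0 eq_sym expf_eq0.
by rewrite (negPf (prim_root_natf_neq0 theta_prim)) andbF.
Qed.

Lemma lambda_neq0 : lambda != 0.
Proof.
apply: mulf_neq0; last by rewrite invr_eq0 -unitfE -unitmxE mxC_unit.
by rewrite expf_neq0 // oppr_eq0 (prim_root_natf_neq0 theta_prim).
Qed.

Lemma opC_lker0 t : lker (opC t) == 0%VS.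
Proof.
pose g : 'End(W) := endo (fun xi : idx =>
    \sum_(j < r) theta ^- (xi t * j)%N *: basis_vec (replace xi t j)).
apply: (@endo_lker0 _ _ _ _ g r%:R); first exact: (prim_root_natf_neq0 theta_prim).
move=> xi; rewrite endoE linear_sum /=.
under eq_bigr => i _.
  rewrite linearZ /= endoE scaler_sumr replaceE.
  under eq_bigr => j _ do rewrite scalerA replace_replace.
  over.
rewrite exchange_big /= (bigD1 (xi t)) //= [X in _ + X]big1 ?addr0 => [|j neq_j].
  by rewrite -scaler_suml theta_sum eqxx replace_id.
by rewrite -scaler_suml theta_sum eq_sym (negPf neq_j) scale0r.
Qed.

Lemma lambdaC_lker0 t : lker (lambda *: opC t) == 0%VS.
Proof.
apply/lker0P => u v; rewrite !scale_lfunE => /(scalerI lambda_neq0).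
exact: (lker0P (opC_lker0 t)).
Qed.

Definition glA t : GL W := MkGL (opA_lker0 t).
Definition glB t : GL W := MkGL (opB_lker0 t).
Definition glD s t : GL W := MkGL (opD_lker0 s t).
Definition glU t : GL W := MkGL (opU_lker0 t).
Definition gl_lambdaC t : GL W := MkGL (lambdaC_lker0 t).

Definition R : {pred GL W} :=
  generated [pred g | [exists t, g == glA t] || [exists t, g == glB t]].
HB.instance Definition _ := GroupClosed.on R.

Definition G : {pred GL W} :=
  generated [pred g | [|| [exists t, g == gl_lambdaC t],
                          [exists s : 'I_l, exists t : 'I_l,
                             (s < t)%N && (g == glD s t)] |
                          [exists t, g == glU t]]].
HB.instance Definition _ := GroupClosed.on G.

End Operators.

Arguments R {F r} l {theta} theta_prim.
Arguments G {F r} l {theta} theta_prim.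

Section Symplectic.

Variables (F : fieldType) (r l : nat) (theta : F).
Hypotheses (r_prime : prime r) (theta_prim : r.-primitive_root theta).

Local Notation W := (W F r l).
Local Notation R := (R l theta_prim).
Local Notation Rt := (subg_type R).
Local Notation A := (glA theta_prim).
Local Notation B := (@glB F r l).

Definition qcomm (x y : GL W) (k : nat) :=
  forall w, x (y w) = theta ^+ k *: y (x w).

Lemma qcomm1 x : qcomm 1%g x 0.
Proof. by move=> w; rewrite !GL1 scale1r. Qed.

Lemma qcommM x y z j k :
  qcomm x z j -> qcomm y z k -> qcomm (x * y)%g z (j + k).
Proof. by move=> xz yz w; rewrite !GLM yz linearZ /= xz scalerA mulrC exprD. Qed.

Lemma qcomm_opp x y j k : qcomm x y j -> (r %| j + k)%N -> qcomm y x k.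
Proof.
move=> xy rjk w; rewrite xy scalerA -exprD addnC.
by rewrite (eqP (_ : theta ^+ _ == 1)) ?scale1r // -(prim_order_dvd theta_prim).
Qed.

Lemma dvd_r_opp k : (r %| k + k * r.-1)%N.
Proof. by rewrite -mulnS prednK ?prime_gt0 ?dvdn_mull. Qed.

Lemma qcommV x y j : qcomm x y j -> qcomm x^-1%g y (j * r.-1).
Proof.
move=> xy w; apply: (lker0P (GL_lker0 x)); rewrite linearZ /= xy.
have xK u : x ((x^-1)%g u) = u by rewrite -GLM mulgV GL1.
rewrite !xK scalerA -exprD addnC (eqP (_ : theta ^+ _ == 1)) ?scale1r //.
by rewrite -(prim_order_dvd theta_prim) dvd_r_opp.
Qed.

Lemma qcomm_glAB s t : qcomm (A s) (B t) (s == t).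
Proof.
move=> w; rewrite -GLM -[B t _]GLM -scale_lfunE; apply/basisP: w => xi.
rewrite scale_lfunE !comp_lfunE /= !endoE linearZ /= endoE scalerA -exprD.
congr (_ *: _); rewrite ffunE; case: eqP => [->|_] //=.
rewrite (prim_expr_mod theta_prim) addnC addn1 //.
Qed.

Lemma qcomm_glAA s t : qcomm (A s) (A t) 0.
Proof.
move=> w; rewrite scale1r -!GLM; apply/basisP: w => xi.
by rewrite !comp_lfunE /= !endoE !linearZ /= !endoE !scalerA mulrC.
Qed.

Lemma qcomm_glBB s t : qcomm (B s) (B t) 0.
Proof.
move=> w; rewrite scale1r -!GLM; apply/basisP: w => xi.
rewrite !comp_lfunE /= !endoE; case: (eqVneq s t) => [->//|neq_st].
congr basis_vec; apply/ffunP => u; rewrite !ffunE.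
rewrite (negPf neq_st) [t == s]eq_sym (negPf neq_st).
by case: (eqVneq u s) => // ->; rewrite (negPf neq_st).
Qed.

Lemma glA_R t : A t \in R.
Proof. by apply: mem_generated; apply/orP; left; apply/existsP; exists t. Qed.

Lemma glB_R t : B t \in R.
Proof. by apply: mem_generated; apply/orP; right; apply/existsP; exists t. Qed.

Lemma R_ind (P : GL W -> Prop) :
    (forall t, P (A t)) -> (forall t, P (B t)) -> P 1%g ->
    (forall x y, P x -> P y -> P (x * y)%g) -> (forall x, P x -> P x^-1%g) ->
  {in R, forall x, P x}.
Proof.
move=> PA PB; apply: generated_ind => x /orP[] /existsP[t /eqP->]; first exact: PA.
exact: PB.
Qed.

Lemma qcomm_R : {in R &, forall x y, exists k, qcomm x y k}.
Proof.
have step z : (forall t, exists k, qcomm (A t) z k) ->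
    (forall t, exists k, qcomm (B t) z k) -> {in R, forall x, exists k, qcomm x z k}.
  move=> zA zB; apply: R_ind => // [|x y [j xz] [k yz]|x [k xz]].
  - by exists 0; apply: qcomm1.
  - by exists (j + k)%N; apply: qcommM.
  - by exists (k * r.-1)%N; apply: qcommV.
have sym x z : (exists k, qcomm x z k) -> exists k, qcomm z x k.
  by case=> k /qcomm_opp zx; exists (k * r.-1)%N; apply/zx/dvd_r_opp.
move=> x y Rx Ry; apply: (step) Rx => t; apply: (sym); apply: (step) Ry => s.
- by exists 0; apply: qcomm_glAA.
- by apply: (sym); exists (nat_of_bool (t == s)); apply: qcomm_glAB.
- by exists (nat_of_bool (s == t)); apply: qcomm_glAB.
- by exists 0; apply: qcomm_glBB.
Qed.

(* The exponent k with [x, y] = theta ^+ k I_W; it exists by comm_exponentP. *)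
Definition comm_exponent (x y : Rt) : 'F_r :=
  odflt 0 [pick k : 'F_r | GL_lfun (val [~ x, y]%g) == theta ^+ k *: \1%VF].

Local Notation e := comm_exponent.

Lemma Fp_card : (Zp_trunc (pdiv r)).+2 = r. Proof. exact: Fp_cast. Qed.

Lemma theta_Fp (k : nat) : theta ^+ (k%:R : 'F_r) = theta ^+ k.
Proof. by rewrite val_Fp_nat // (prim_expr_mod theta_prim). Qed.

Lemma qcomm_commgP (x y : Rt) k :
  qcomm (val x) (val y) k <-> GL_lfun (val [~ x, y]%g) = theta ^+ k *: \1%VF.
Proof.
have -> : val [~ x, y]%g = [~ val x, val y]%g by [].
have E : (val x * val y = val y * val x * [~ val x, val y])%g.
  by rewrite commgEl conjgE !mulgA mulgK mulgV mul1g.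
split=> [xy|c w].
  apply/lfunP => w; apply: (lker0P (GL_lker0 (val y * val x)%g)).
  rewrite -[LHS]GLM -E !GLM xy scale_lfunE id_lfunE.
  by rewrite !linearZ.
by rewrite -[LHS]GLM E GLM c scale_lfunE id_lfunE linearZ /= GLM.
Qed.

Lemma comm_exponentP (x y : Rt) :
  GL_lfun (val [~ x, y]%g) = theta ^+ e x y *: \1%VF.
Proof.
rewrite /e; case: pickP => [k /eqP //|no_k].
have [k /qcomm_commgP xy] := qcomm_R (valP x) (valP y).
by have /eqP[] := no_k k%:R; rewrite theta_Fp.
Qed.

Lemma qcomm_e (x y : Rt) : qcomm (val x) (val y) (e x y).
Proof. by apply/qcomm_commgP/comm_exponentP. Qed.

Lemma W_neq0 : exists w : W, w != 0.
Proof.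
pose i0 : 'I_r := Ordinal (prim_order_gt0 theta_prim).
exists (basis_vec [ffun=> i0]); apply/eqP => /ffunP/(_ [ffun=> i0]).
by rewrite !ffunE eqxx => /eqP; rewrite oner_eq0.
Qed.

Lemma qcomm_unique (x y : Rt) k : qcomm (val x) (val y) k -> e x y = k%:R.
Proof.
move=> xy; have [w w0] := W_neq0; have yxw0 : (val y) ((val x) w) != 0.
  rewrite -GLM; apply: contra w0 => /eqP E.
  by apply/eqP/(lker0P (GL_lker0 (val y * val x)%g)); rewrite E linear0.
have /eqP := qcomm_e x y w; rewrite (xy w) -subr_eq0 -scalerBl scaler_eq0.
rewrite (negPf yxw0) orbF subr_eq0 (eq_prim_root_expr theta_prim) => /eqP E.
apply/val_inj; rewrite /= val_Fp_nat // E modn_small //.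
by rewrite -[X in (_ < X)%N]Fp_card.
Qed.

Lemma eM x y z : e (x * y)%g z = e x z + e y z.
Proof.
rewrite (@qcomm_unique (x * y)%g z _ (qcommM (qcomm_e x z) (qcomm_e y z))).
by rewrite natrD !natr_Zp.
Qed.

Lemma eC x y : e y x = - e x y.
Proof.
apply/eqP; rewrite -addr_eq0 addrC; apply/eqP.
rewrite (qcomm_unique (qcomm_opp (qcomm_e x y) (dvd_r_opp _))).
rewrite -{1}[e x y]natr_Zp -natrD -mulnS prednK ?prime_gt0 //.
by apply/val_inj; rewrite /= val_Fp_nat // modnMl.
Qed.

Lemma e1 z : e 1%g z = 0.
Proof. exact: (@qcomm_unique 1%g z _ (qcomm1 (val z))). Qed.

Lemma eV x z : e x^-1%g z = - e x z.
Proof. by apply/eqP; rewrite -addr_eq0 -eM mulVg e1. Qed.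

Lemma eX x z k : e (x ^+ k)%g z = k%:R * e x z.
Proof.
elim: k => [|k IHk]; first by rewrite mul0r; apply: e1.
by rewrite expgS eM IHk -[in RHS]add1n natrD mulrDl mul1r.
Qed.

Lemma eMr x y z : e x (y * z)%g = e x y + e x z.
Proof. by rewrite eC eM opprD -!eC. Qed.

Lemma eVr x y : e x y^-1%g = - e x y.
Proof. by rewrite eC eV -eC. Qed.

(* R / Z(R), written additively.  The vector space structure over 'F_r needs r
   to be prime, so the proof is a parameter of the type that carries it. *)
Definition Rbar of prime r := central_quotient Rt.

Local Notation Q := (Rbar r_prime).

HB.instance Definition _ := EqQuotient.on Q.
HB.instance Definition _ := Choice.on Q.

Definition coset_of_R (x : Rt) : Q := \pi_Q%qT x.

Local Notation cl := coset_of_R.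

Lemma clP x y : cl x = cl y <-> forall z, e x z = e y z.
Proof.
have -> : (cl x = cl y) <-> same_coset x y by split => /eqmodP.
split=> [/centreP c z|exy].
  apply/eqP; rewrite eq_sym -subr_eq0 addrC -eV -eM.
  apply/eqP; apply: (@qcomm_unique _ _ 0) => w.
  rewrite scale1r -[LHS]GLM -[RHS]GLM.
  exact: (congr1 (fun g : Rt => (val g : GL W) w) (c z)).
apply/centreP => z; apply/val_inj/GLP => w.
have := qcomm_e (x^-1 * y)%g z w; rewrite eM eV exy addNr scale1r => E.
exact: etrans (GLM _ _ _) (etrans E (esym (GLM _ _ _))).
Qed.

Lemma cl_repr (u : Q) : cl (repr u) = u.
Proof. exact: reprK. Qed.

Lemma e_repr x z : e (repr (cl x)) z = e x z.
Proof. by apply: (clP _ _).1; apply: cl_repr. Qed.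

Definition Rbar_add (u v : Q) : Q := cl (repr u * repr v)%g.
Definition Rbar_zero : Q := cl 1%g.
Definition Rbar_opp (u : Q) : Q := cl (repr u)^-1%g.
(* k *: (x Z(R)) = x ^ k Z(R) *)
Definition Rbar_scale (k : 'F_r) (u : Q) : Q := cl (repr u ^+ k)%g.

Let eE := (e_repr, eM, e1, eV, eX, @natr_Zp).

Fact Rbar_addA : associative Rbar_add.
Proof. by move=> u v w; apply/clP => z; rewrite !eE addrA. Qed.
Fact Rbar_addC : commutative Rbar_add.
Proof. by move=> u v; apply/clP => z; rewrite !eE addrC. Qed.
Fact Rbar_add0 : left_id Rbar_zero Rbar_add.
Proof. by move=> u; rewrite -[RHS]cl_repr; apply/clP => z; rewrite !eE add0r. Qed.
Fact Rbar_addN : left_inverse Rbar_zero Rbar_opp Rbar_add.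
Proof. by move=> u; apply/clP => z; rewrite !eE addNr. Qed.

HB.instance Definition _ :=
  GRing.isZmodule.Build Q Rbar_addA Rbar_addC Rbar_add0 Rbar_addN.

Lemma clM x y : cl (x * y)%g = cl x + cl y.
Proof. by apply/clP => z; rewrite !eE. Qed.

Fact Rbar_scaleA k m u : Rbar_scale k (Rbar_scale m u) = Rbar_scale (k * m) u.
Proof. by apply/clP => z; rewrite !eE mulrA. Qed.
Fact Rbar_scale1 : left_id 1 Rbar_scale.
Proof. by move=> u; rewrite -[RHS]cl_repr; apply/clP => z; rewrite !eE mul1r. Qed.
Fact Rbar_scaleDr : right_distributive Rbar_scale +%R.
Proof. by move=> k u v; apply/clP => z; rewrite !eE mulrDr. Qed.
Fact Rbar_scaleDl u : {morph Rbar_scale^~ u : k m / k + m}.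
Proof. by move=> k m; apply/clP => z; rewrite !eE mulrDl. Qed.

HB.instance Definition _ := GRing.Zmodule_isLmodule.Build 'F_r Q
  Rbar_scaleA Rbar_scale1 Rbar_scaleDr Rbar_scaleDl.

Lemma clX x (k : 'F_r) : cl (x ^+ k)%g = k *: cl x.
Proof. by apply/clP => z; rewrite !eE. Qed.

Definition comm_form (u v : Q) : 'F_r := e (repr u) (repr v).

Local Notation b := comm_form.

Lemma comm_form_cl x y : b (cl x) (cl y) = e x y.
Proof. by rewrite /b e_repr eC e_repr -eC. Qed.

Lemma comm_formP x y :
  GL_lfun (val [~ x, y]%g) = theta ^+ b (cl x) (cl y) *: \1%VF.
Proof. by rewrite comm_form_cl comm_exponentP. Qed.

Lemma comm_formDl u v w : b (u + v) w = b u w + b v w.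
Proof. by rewrite /b !eE. Qed.

Lemma comm_formZl k u w : b (k *: u) w = k * b u w.
Proof. by rewrite /b !eE. Qed.

Lemma comm_formN u v : b v u = - b u v.
Proof. exact: eC. Qed.

Lemma comm_form_alt u : b u u = 0.
Proof.
by apply: (@qcomm_unique _ _ 0) => w; rewrite scale1r.
Qed.

Lemma comm_form_nondeg u : (forall v, b u v = 0) -> u = 0.
Proof.
move=> u0; rewrite -[LHS]cl_repr; apply/clP => z.
by rewrite e1 -[RHS](u0 (cl z)) -{2}(cl_repr u) comm_form_cl.
Qed.

Definition inR x (Rx : x \in R) : Rt := Sub x Rx.

Definition Rgen_A t : Rt := inR (glA_R t).
Definition Rgen_B t : Rt := inR (glB_R t).

Lemma comm_form_AB s t : b (cl (Rgen_A s)) (cl (Rgen_B t)) = (s == t)%:R.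
Proof.
by rewrite comm_form_cl; exact: (@qcomm_unique (Rgen_A s) (Rgen_B t) _ (qcomm_glAB s t)).
Qed.

Lemma comm_form_AA s t : b (cl (Rgen_A s)) (cl (Rgen_A t)) = 0.
Proof.
by rewrite comm_form_cl; exact: (@qcomm_unique (Rgen_A s) (Rgen_A t) _ (qcomm_glAA s t)).
Qed.

Lemma comm_form_BB s t : b (cl (Rgen_B s)) (cl (Rgen_B t)) = 0.
Proof.
by rewrite comm_form_cl; exact: (@qcomm_unique (Rgen_B s) (Rgen_B t) _ (qcomm_glBB s t)).
Qed.

Lemma e_eq_gens x y :
    (forall t, e x (Rgen_A t) = e y (Rgen_A t)) ->
    (forall t, e x (Rgen_B t) = e y (Rgen_B t)) ->
  cl x = cl y.
Proof.
move=> xyA xyB; apply/clP => z.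
suff [Rz] : exists Rz : val z \in R, e x (inR Rz) = e y (inR Rz).
  by rewrite (_ : inR Rz = z) //; apply/val_inj.
move: (val z) (valP z); apply: R_ind.
- by move=> t; exists (glA_R t); apply: xyA.
- by move=> t; exists (glB_R t); apply: xyB.
- exists gpred1; rewrite (_ : inR _ = 1%g :> Rt); last exact/val_inj.
  by rewrite eC e1 eC e1.
- move=> u v [Ru Eu] [Rv Ev]; exists (gpredM _ _ Ru Rv).
  rewrite (_ : inR _ = inR Ru * inR Rv :> Rt)%g; last exact/val_inj.
  by rewrite !eMr Eu Ev.
- move=> u [Ru Eu]; exists (gpredVr _ Ru).
  rewrite (_ : inR _ = (inR Ru : Rt)^-1)%g; last exact/val_inj.
  by rewrite !eVr Eu.
Qed.

Definition coords (u : Q) : 'rV['F_r]_(l + l) :=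
  row_mx (\row_t b u (cl (Rgen_B t))) (\row_t b u (cl (Rgen_A t))).

Definition of_coords (c : 'rV['F_r]_(l + l)) : Q :=
  \sum_t (c 0 (lshift l t) *: cl (Rgen_A t) - c 0 (rshift l t) *: cl (Rgen_B t)).

Fact coords_linear : linear coords.
Proof.
move=> k u v; rewrite /coords scale_row_mx add_row_mx.
by congr row_mx; apply/rowP => t; rewrite !mxE comm_formDl comm_formZl.
Qed.

Lemma coords_inj : injective coords.
Proof.
move=> u v /eq_row_mx[uvB uvA]; rewrite -[u]cl_repr -[v]cl_repr.
apply: e_eq_gens => t; rewrite -!comm_form_cl !cl_repr.
  by have /rowP/(_ t) := uvA; rewrite !mxE.
by have /rowP/(_ t) := uvB; rewrite !mxE.
Qed.

Lemma of_coordsK : cancel of_coords coords.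
Proof.
have b_sum f v : b (\sum_(t < l) f t) v = \sum_(t < l) b (f t) v.
  have b0 : b 0 v = 0 by rewrite -[0](scale0r (0 : Q)) comm_formZl mul0r.
  exact: (big_morph (b^~ v) (fun x y => comm_formDl x y v) b0).
have bB u v w : b (u - v) w = b u w - b v w.
  by rewrite comm_formDl -scaleN1r comm_formZl mulN1r.
move=> c; rewrite -[RHS]hsubmxK; congr row_mx; apply/rowP => t; rewrite !mxE b_sum.
  rewrite (bigD1 t) //= big1 ?addr0 => [|s /negPf st]; last first.
    by rewrite bB !comm_formZl comm_form_AB comm_form_BB st !mulr0 subrr.
  by rewrite bB !comm_formZl comm_form_AB comm_form_BB eqxx mulr1 mulr0 subr0.
rewrite (bigD1 t) //= big1 ?addr0 => [|s /negPf st]; last first.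
  rewrite bB !comm_formZl comm_form_AA comm_formN comm_form_AB eq_sym st.
  by rewrite oppr0 !mulr0 subrr.
rewrite bB !comm_formZl comm_form_AA comm_formN comm_form_AB eqxx.
by rewrite mulr0 mulrN1 opprK add0r.
Qed.

Fact coords_vector_axiom : Vector.axiom (l + l) Q.
Proof.
exists coords; first exact: coords_linear.
by exists of_coords; [apply: inj_can_sym of_coordsK coords_inj | apply: of_coordsK].
Qed.

HB.instance Definition _ := Lmodule_hasFinDim.Build 'F_r Q coords_vector_axiom.

Lemma dim_Rbar : dim Q = l.*2.
Proof. by rewrite /dim /= addnn. Qed.

Definition Sp : {pred GL Q} := isometries b.
HB.instance Definition _ := GroupClosed.on Sp.

Definition normR : {pred GL W} := normaliser R.
HB.instance Definition _ := GroupClosed.on normR.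

Section Action.

Variable g : subg_type normR.

Fact conj_in_R (x : Rt) : (val g * val x * (val g)^-1)%g \in R.
Proof. by rewrite ((normaliserP _ _ (valP g)) (val x)) (valP x). Qed.

Definition conj_R (x : Rt) : Rt := inR (conj_in_R x).

Definition conj_Rbar (u : Q) : Q := cl (conj_R (repr u)).

Lemma e_conj x y : e (conj_R x) (conj_R y) = e x y.
Proof.
rewrite -[RHS]natr_Zp; apply: qcomm_unique => w.
have gK v : (val g)^-1%g (val g v) = v by rewrite -GLM mulVg GL1.
have cE z v : val (conj_R z) v = val g (val z ((val g)^-1%g v)).
  exact: etrans (GLM _ _ _) (GLM _ _ _).
by rewrite !cE !gK (qcomm_e x y) linearZ.
Qed.

Lemma conj_R_surj y : exists x, y = conj_R x.
Proof.
have Ry : ((val g)^-1 * val y * val g)%g \in R.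
  have := normaliserP _ _ (valP g) ((val g)^-1 * val y * val g)%g.
  by rewrite !mulgA mulgV mul1g mulgK (valP y).
exists (inR Ry); apply/val_inj; rewrite !SubK.
by rewrite !mulgA mulgV mul1g mulgK.
Qed.

Lemma conj_Rbar_cl x : conj_Rbar (cl x) = cl (conj_R x).
Proof.
by apply/clP => z; have [y ->] := conj_R_surj z; rewrite !e_conj e_repr.
Qed.

Fact conj_Rbar_linear : linear conj_Rbar.
Proof.
move=> k u v; rewrite -[u]cl_repr -[v]cl_repr -clX -clM !conj_Rbar_cl -clX -clM.
by apply/clP => z; have [y ->] := conj_R_surj z; rewrite !(e_conj, eE).
Qed.

HB.instance Definition _ :=
  GRing.isLinear.Build 'F_r Q Q _ conj_Rbar conj_Rbar_linear.

Fact conj_Rbar_lker0 : lker (linfun conj_Rbar) == 0%VS.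
Proof.
apply/lker0P => u v; rewrite !lfunE /= => /clP uv.
rewrite -[u]cl_repr -[v]cl_repr; apply/clP => z.
by rewrite -e_conj uv e_conj.
Qed.

Definition conj_GL : GL Q := MkGL conj_Rbar_lker0.

Lemma conj_GL_cl x : conj_GL (cl x) = cl (conj_R x).
Proof. by rewrite lfunE /= conj_Rbar_cl. Qed.

Fact conj_GL_isometry : conj_GL \in Sp.
Proof.
apply/isometriesP => u v; rewrite -[u]cl_repr -[v]cl_repr !conj_GL_cl.
by rewrite !comm_form_cl e_conj.
Qed.

Definition pi_Sp : subg_type Sp := Sub conj_GL conj_GL_isometry.

End Action.

Lemma pi_Sp_cl g x : val (pi_Sp g) (cl x) = cl (conj_R g x).
Proof. exact: conj_GL_cl. Qed.

Fact pi_Sp_mulg : {morph pi_Sp : g h / (g * h)%g}.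
Proof.
move=> g h; apply/val_inj/GLP => u; rewrite -[u]cl_repr [RHS]GLM !pi_Sp_cl.
by congr cl; apply/val_inj; rewrite !SubK invgM !mulgA.
Qed.

HB.instance Definition _ :=
  isMultiplicative.Build (subg_type normR) (subg_type Sp) pi_Sp pi_Sp_mulg.

End Symplectic.

Arguments normR {F r} l {theta} theta_prim.
Arguments Sp {F r} l {theta} r_prime theta_prim.
Arguments pi_Sp {F r l theta} r_prime {theta_prim} g.

(* Main.v *)
From HB Require Import structures.
Require Import Defs.
From mathcomp Require Import all_boot all_order all_algebra.
From mathcomp Require Import boolp ring zify.
Import GRing.Theory.

Set Implicit Arguments.
Unset Strict Implicit.
Unset Printing Implicit Defensive.

Local Open Scope ring_scope.

(** Conjugation by G acts on R / Z(R) by isometries of the commutator form. The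
    theorem says that every isometry arises in this way, from one element of G
    only.

    Surjectivity. Up to scalars, conjugation by U_t takes B_t to B_t A_t and
    fixes the other generators of R: it is a transvection whose centre is the
    class of A_t. Conjugation by lambda C_t takes A_t to the inverse of B_t, and
    conjugation by D_st takes B_s to B_s A_t and B_t to B_t A_s. A group of
    isometries that contains such elements contains the transvections with
    every possible centre ([center_all]), because its elements permute these
    centres and can spread a centre from one hyperbolic plane to another. The
    transvections generate the symplectic group ([transvections_generate]).

    Injectivity. The parity P, which takes v_xi to v_(- xi), commutes with the
    generators of G, and conjugation by P inverts A_t and B_t. An element g of G
    that acts trivially on R / Z(R) commutes with A_t up to a scalar c;
    conjugating by P gives c = 1 / c, and c ^ r = 1 with r odd, hence c = 1
    ([parity_commute]). So g commutes with R, and by Schur's lemma ([R_schur]) it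
    is a scalar. It remains to see that G contains no scalar other than 1.

    Let W+ be the space of the vectors fixed by P, and W- the span of the vectors
    v_xi - v_(- xi). An operator g that commutes with P preserves both, and
    det(g on W+) / det(g on W-) is multiplicative in g. As dim W+ = dim W- + 1,
    this superdeterminant takes the scalar c to c. This holds in characteristic 2
    as well, where W- is a part of W+. It suffices to show that the generators
    of G have superdeterminant 1. A diagonal operator that commutes with P has
    its entry at xi = 0 for superdeterminant ([superdet_diag]), which is 1 for
    U_t and D_st.

    For C_t one uses relations between the r x r matrices C and U of which C_t and
    U_t are the actions on one tensor factor of W:
      (U C) ^ 3 = rho,  C ^ 4 = r ^ 2,  C ^ 2 = r P,
    where rho is r times a quadratic Gauss sum. Let d be the superdeterminant of
    C. The relations give d ^ 3 = rho, d ^ 4 = r ^ 2 and d ^ 2 = (-1) ^ k r with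
    k = (r - 1) / 2. Taking determinants instead, det C and d ^ r have the same
    third and fourth powers, so that det C = d ^ r and
      lambda d = (- r) ^ k d / d ^ r = (- r) ^ k / (d ^ 2) ^ k = 1
    ([lambda_sdetC]). The relations hold for C_t and U_t too, so the
    superdeterminant of C_t has the same third and fourth powers as d, hence is d
    ([sdet_opC]), and that of lambda C_t is 1. The Gauss sum is never evaluated. *)

(** * Generation of the symplectic group *)

Section SymplecticGeneration.

Variables (K : fieldType) (V : vectType K) (b : V -> V -> K).
Hypothesis bDl : forall u v w, b (u + v) w = b u w + b v w.
Hypothesis bZl : forall k u w, b (k *: u) w = k * b u w.
Hypothesis bN : forall u v, b v u = - b u v.
Hypothesis bxx : forall u, b u u = 0.

Lemma formNl u w : b (- u) w = - b u w.
Proof. by rewrite -scaleN1r bZl mulN1r. Qed.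
Lemma formBl u v w : b (u - v) w = b u w - b v w.
Proof. by rewrite bDl formNl. Qed.
Lemma formDr u v w : b w (u + v) = b w u + b w v.
Proof. by rewrite bN bDl opprD -!bN. Qed.
Lemma formZr k u w : b w (k *: u) = k * b w u.
Proof. by rewrite bN bZl -mulrN -bN. Qed.
Lemma formNr u w : b w (- u) = - b w u.
Proof. by rewrite bN formNl -bN. Qed.
Lemma formBr u v w : b w (u - v) = b w u - b w v.
Proof. by rewrite formDr formNr. Qed.

Definition transvection_fun (c : K) (v u : V) : V := u + (c * b u v) *: v.

Fact transvection_linear c v : linear (transvection_fun c v).
Proof.
move=> k u w; rewrite /transvection_fun bDl bZl scalerDr addrACA scalerA.
by rewrite -scalerDl mulrDr mulrCA.
Qed.

HB.instance Definition _ c v :=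
  GRing.isLinear.Build K V V _ (transvection_fun c v) (transvection_linear c v).

Lemma transvection_funD c d v u :
  transvection_fun c v (transvection_fun d v u) = transvection_fun (c + d) v u.
Proof.
rewrite /transvection_fun bDl bZl bxx mulr0 addr0 -addrA -scalerDl.
by rewrite mulrDl [d * _ + _]addrC.
Qed.

Fact transvection_lker0 c v : lker (linfun (transvection_fun c v)) == 0%VS.
Proof.
apply/lker0P; apply: (@can_inj _ _ _ (transvection_fun (- c) v)) => u.
by rewrite lfunE /= transvection_funD addNr /transvection_fun mul0r scale0r addr0.
Qed.

Definition transvection c v : GL V := MkGL (transvection_lker0 c v).

Lemma transvectionE c v u : transvection c v u = u + (c * b u v) *: v.
Proof. by rewrite lfunE. Qed.

Lemma transvectionX c v n : (transvection c v ^+ n)%g = transvection (n%:R * c) v.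
Proof.
elim: n => [|n IHn]; apply/GLP => u.
  by rewrite GL1 transvectionE !mul0r scale0r addr0.
rewrite expgS IHn GLM !lfunE /= transvection_funD.
by rewrite -natr1 mulrDl mul1r addrC.
Qed.

Lemma transvection_conj (g : GL V) c v : g \in isometries b ->
  (g * transvection c v * g^-1)%g = transvection c (g v).
Proof.
move/isometriesP => bg; apply/GLP => u.
have gK w : g ((g^-1)%g w) = w by rewrite -GLM mulgV GL1.
by rewrite !GLM !transvectionE linearD linearZ /= gK -[in b _ v]bg gK.
Qed.

Variable H : groupClosed (GL V).

(** If neither of two given partners works for both vectors, their sum does. *)
Lemma common_partner (E : V -> Prop) u u' :
    (forall v w, E v -> E w -> E (v + w)) ->
    (exists2 q, E q & b u q != 0) -> (exists2 q, E q & b u' q != 0) ->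
  exists q, [/\ E q, b u q != 0 & b u' q != 0].
Proof.
move=> ED [p Ep up] [q Eq u'q].
have [uq|] := eqVneq (b u q) 0; last by exists q.
have [u'p|] := eqVneq (b u' p) 0; last by exists p.
by exists (p + q); split; rewrite ?formDr ?uq ?u'p ?addr0 ?add0r //; apply: ED.
Qed.

(** A transvection with centre u' - u takes u to u' when these are not orthogonal.
    Otherwise one moves u to u + q first, where q is a common partner of u and
    u'. All the centres used lie in E, so E^perp is fixed. *)
Lemma transvection_move (E : V -> Prop) u u' :
    (forall v w, E v -> E w -> E (v + w)) -> (forall v, E v -> E (- v)) ->
    (forall c w, E w -> transvection c w \in H) ->
    E (u' - u) ->
    (exists2 q, E q & b u q != 0) -> (exists2 q, E q & b u' q != 0) ->
  exists h : GL V, [/\ h \in H, h u = u' &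
    forall z, (forall w, E w -> b z w = 0) -> h z = z].
Proof.
move=> ED EN EH Ed Eu Eu'.
have direct v v' : E (v' - v) -> b v v' != 0 -> exists h : GL V,
    [/\ h \in H, h v = v' & forall z, (forall w, E w -> b z w = 0) -> h z = z].
  move=> Ev vv'; exists (transvection (b v v')^-1 (v' - v)); split; first exact: EH.
    by rewrite transvectionE formBr bxx subr0 mulVf // scale1r addrC subrK.
  by move=> z Ez; rewrite transvectionE Ez // mulr0 scale0r addr0.
have [uu'|] := eqVneq (b u u') 0; last exact: direct.
have [q [Eq uq u'q]] := common_partner ED Eu Eu'.
have [||h [Hh hu hz]] := direct u (u + q).
- by rewrite addrC addKr.
- by rewrite formDr bxx add0r.
have [||h' [Hh' hu' hz']] := direct (u + q) u'.
- by rewrite opprD addrA; apply: ED => //; apply: EN.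
- by rewrite bDl uu' add0r bN oppr_eq0.
exists (h' * h)%g; split; first exact: gpredM.
  by rewrite GLM hu.
by move=> z Ez; rewrite GLM hz // hz'.
Qed.

Hypothesis H_iso : {subset H <= isometries b}.

(** An isometry is brought to fix the vectors of s one at a time: the next
    vector v and its image differ by a vector orthogonal to those already
    fixed, and the vector d dual to v shows that both pair nontrivially
    with that orthogonal complement. *)
Lemma transvections_fix (g : GL V) (s : seq V) :
    (forall c v, transvection c v \in H) -> g \in isometries b ->
    {in s, forall v, exists2 d, b v d != 0 & {in s, forall w, w != v -> b w d = 0}} ->
  exists2 h, h \in H & {in s, forall v, (h * g)%g v = v}.
Proof.
move=> TH g_iso; elim: s => [|v s IHs] dual; first by exists 1%g; rewrite ?gpred1.
have [|h Hh fix_s] := IHs.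
  move=> w sw; have [d wd d0] := dual w (mem_behead (s := v :: s) sw).
  by exists d => // x sx; apply/d0/mem_behead.
have [sv|s'v] := boolP (v \in s).
  by exists h => // w; rewrite inE => /predU1P[->|]; apply: fix_s.
have [d vd d0] := dual v (mem_head _ _).
pose E w := {in s, forall x, b x w = 0}.
have hg_iso : (h * g)%g \in isometries b by apply: gpredM => //; apply: H_iso.
have bhg x y : b ((h * g)%g x) ((h * g)%g y) = b x y by move/isometriesP: hg_iso.
have Ed : E d.
  by move=> x sx; apply: d0; rewrite ?(inE, sx, orbT) //; apply: contraNneq s'v => <-.
have [||||||h' [Hh' h'v fixE]] := @transvection_move E ((h * g)%g v) v.
- by move=> x y Ex Ey z sz; rewrite formDr Ex ?Ey ?addr0.
- by move=> x Ex z sz; rewrite formNr Ex ?oppr0.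
- by move=> c w _; apply: TH.
- by move=> x sx; rewrite formBr -{2}(fix_s x sx) bhg subrr.
- exists ((h * g)%g d); last by rewrite bhg.
  by move=> x sx; rewrite -(fix_s x sx) bhg Ed.
- by exists d.
exists (h' * h)%g; first exact: gpredM.
move=> w; rewrite inE -mulgA GLM => /predU1P[->|sw]; first exact: h'v.
by rewrite (fix_s w sw); apply: fixE => x Ex; rewrite Ex.
Qed.

Variables (l : nat) (a c : 'I_l -> V).
Hypothesis b_ac : forall s t, b (a s) (c t) = (s == t)%:R.
Hypothesis b_aa : forall s t, b (a s) (a t) = 0.
Hypothesis b_cc : forall s t, b (c s) (c t) = 0.
Hypothesis b_sep : forall u,
  (forall t, b u (a t) = 0) -> (forall t, b u (c t) = 0) -> u = 0.

Lemma b_ca s t : b (c s) (a t) = - (s == t)%:R.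
Proof. by rewrite bN b_ac eq_sym. Qed.

Lemma transvections_generate :
  (forall k v, transvection k v \in H) -> {subset isometries b <= H}.
Proof.
move=> TH g g_iso; pose s := codom a ++ codom c.
have neq0 t : (t == t)%:R != 0 :> K by rewrite eqxx oner_eq0.
have [|h Hh fix_s] := @transvections_fix g s TH g_iso.
  move=> v; rewrite mem_cat => /orP[] /codomP[t ->].
    exists (c t); first by rewrite b_ac.
    move=> w; rewrite mem_cat => /orP[] /codomP[x ->] neq; last by rewrite b_cc.
    by rewrite b_ac; case: (eqVneq x t) neq => [->|_ _]; rewrite ?eqxx.
  exists (a t); first by rewrite b_ca oppr_eq0.
  move=> w; rewrite mem_cat => /orP[] /codomP[x ->] neq; first by rewrite b_aa.
  by rewrite b_ca; case: (eqVneq x t) neq => [->|_ _]; rewrite ?eqxx ?oppr0.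
suff hg1 : (h * g)%g = 1%g.
  by have -> : g = (h^-1)%g; rewrite ?gpredV // -[h^-1%g]mulg1 -hg1 mulKg.
have /isometriesP hg_iso : (h * g)%g \in isometries b.
  by apply: gpredM => //; apply: H_iso.
apply/GLP => u; rewrite GL1; apply/eqP; rewrite -subr_eq0; apply/eqP.
apply: b_sep => t; rewrite formBl.
  by rewrite -{1}(fix_s (a t)) ?hg_iso ?subrr // mem_cat codom_f.
by rewrite -{1}(fix_s (c t)) ?hg_iso ?subrr // mem_cat codom_f orbT.
Qed.

(* A root subgroup in each hyperbolic plane, an element exchanging the two
   isotropic lines of that plane, and an element mixing two planes. *)
Hypothesis H_root : forall k t, transvection k (a t) \in H.
Hypothesis H_weyl : forall t, exists2 h, h \in H & h (a t) = - c t.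
Hypothesis H_mixed : forall s t : 'I_l, (s < t)%N -> exists2 h, h \in H &
  forall u, h u = u - b u (a t) *: a s - b u (a s) *: a t.

Definition is_center v := forall k, transvection k v \in H.

Lemma center_img h v : h \in H -> is_center v -> is_center (h v).
Proof.
by move=> Hh Xv k; rewrite -transvection_conj ?H_iso // !gpredM ?gpredV.
Qed.

Lemma centerN v : is_center v -> is_center (- v).
Proof.
move=> Xv k; rewrite (_ : transvection k (- v) = transvection k v) //.
by apply/GLP => u; rewrite !transvectionE formNr mulrN scaleNr scalerN opprK.
Qed.

Lemma centerZ k v : is_center v -> is_center (k *: v).
Proof.
move=> Xv j; rewrite (_ : transvection j _ = transvection (j * k * k) v) //.
by apply/GLP => u; rewrite !transvectionE formZr scalerA -!mulrA [b u v * k]mulrC.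
Qed.

Lemma center_c t : is_center (c t).
Proof.
have [h Hh /(congr1 -%R)] := H_weyl t; rewrite opprK => <-.
by apply/centerN/center_img => //; apply: H_root.
Qed.

Definition plane t v := exists x y, v = x *: a t + y *: c t.

Definition meets t v := (b v (a t) != 0) || (b v (c t) != 0).

Lemma plane_a t : plane t (a t).
Proof. by exists 1, 0; rewrite scale1r scale0r addr0. Qed.
Lemma plane_c t : plane t (c t).
Proof. by exists 0, 1; rewrite scale1r scale0r add0r. Qed.
Lemma planeD t v w : plane t v -> plane t w -> plane t (v + w).
Proof.
by move=> [x [y ->]] [x' [y' ->]]; exists (x + x'), (y + y'); rewrite !scalerDl addrACA.
Qed.
Lemma planeN t v : plane t v -> plane t (- v).
Proof. by move=> [x [y ->]]; exists (- x), (- y); rewrite !scaleNr opprD. Qed.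

Lemma meets_partner t v : meets t v -> exists2 q, plane t q & b v q != 0.
Proof.
by case/orP => nz; [exists (a t) | exists (c t)] => //;
  [apply: plane_a | apply: plane_c].
Qed.

Lemma center_plane t v : plane t v -> is_center v.
Proof.
case=> x [y ->]; have [->|x0] := eqVneq x 0.
  by rewrite scale0r add0r; apply/centerZ/center_c.
have -> : x *: a t + y *: c t = transvection (y / x) (c t) (x *: a t).
  by rewrite transvectionE bZl b_ac eqxx mulr1 divfK.
by apply: center_img; [apply: center_c | apply: centerZ => k; apply: H_root].
Qed.

Lemma center_move t u v :
  plane t (v - u) -> meets t u -> meets t v -> is_center u -> is_center v.
Proof.
move=> Puv /meets_partner Mu /meets_partner Mv Xu.
have [h [Hh <- _]] := @transvection_move (plane t) u v (@planeD t) (@planeN t)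
  (fun k w Pw => center_plane Pw k) Puv Mu Mv.
exact: center_img.
Qed.

Definition component t u := b u (c t) *: a t - b u (a t) *: c t.

Lemma plane_component t u : plane t (component t u).
Proof. by exists (b u (c t)), (- b u (a t)); rewrite scaleNr. Qed.

Lemma component_a t u s : b (component t u) (a s) = b u (a t) *+ (t == s).
Proof.
rewrite formBl !bZl b_aa b_ca mulr0 sub0r mulrN opprK.
by case: eqP => _; rewrite ?mulr1 ?mulr0.
Qed.

Lemma component_c t u s : b (component t u) (c s) = b u (c t) *+ (t == s).
Proof.
rewrite formBl !bZl b_cc b_ac mulr0 subr0.
by case: eqP => _; rewrite ?mulr1 ?mulr0.
Qed.

(** By induction on the planes that u may meet. Let u' be the part of u outside
    the t-th plane, and let u' meet the s-th plane. Transvections of that plane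
    replace the s-th component of u' by c s, the mixed element then adds a t, and
    transvections of the two planes turn the result into u. *)
Lemma center_all v : is_center v.
Proof.
have [->|] := eqVneq v 0.
  by rewrite -(scale0r v) => k; rewrite (_ : transvection _ _ = 1%g) ?gpred1 //;
    apply/GLP => u; rewrite transvectionE GL1 scale0r scaler0 addr0.
suff all_k k (u : V) : (k <= l)%N -> u != 0 ->
    (forall t : 'I_l, (k <= t)%N -> ~~ meets t u) -> is_center u.
  by move=> v0; apply: (all_k l v) => // t; rewrite leqNgt ltn_ord.
elim: k u => [|k IHk] u lek u0 u_out.
  case/eqP: u0; apply: b_sep => t; have := u_out t isT.
    by rewrite negb_or !negbK => /andP[/eqP].
  by rewrite negb_or !negbK => /andP[_ /eqP].
pose t := Ordinal lek; pose w := component t u; pose u' := u - w.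
have bu' x : b u' x = b u x - b (component t u) x by apply: formBl.
have u'_in (s : 'I_l) : s != t -> (b u' (a s) = b u (a s)) * (b u' (c s) = b u (c s)).
  move=> /negPf st.
  by rewrite !bu' component_a component_c eq_sym st !mulr0n !subr0.
have u't : (b u' (a t) = 0) * (b u' (c t) = 0).
  by rewrite !bu' component_a component_c eqxx !subrr.
have u'_out (s : 'I_l) : (k <= s)%N -> ~~ meets s u'.
  rewrite leq_eqVlt => /predU1P[ks|ks].
    have -> : s = t by apply/val_inj.
    by rewrite /meets !u't !eqxx.
  have st : s != t by rewrite -val_eqE neq_ltn ks orbT.
  by rewrite /meets !u'_in //; apply: u_out.
have Xu' : u' != 0 -> is_center u' by move=> ?; apply: IHk => //; apply: ltnW.
have [w0|w0] := eqVneq w 0; first by move: Xu'; rewrite /u' w0 subr0; apply.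
have [u'0|u'0] := eqVneq u' 0.
  have -> : u = w by apply/eqP; rewrite -subr_eq0 -/u' u'0.
  exact/center_plane/plane_component.
have [s s_u'] : exists s, meets s u'.
  apply: contrapT => /forallNP no_s; case/eqP: u'0; apply: b_sep => s;
  by have /negP := no_s s; rewrite negb_or !negbK => /andP[/eqP ? /eqP ?].
have lt_st : (s < t)%N by rewrite ltnNge; apply: contraL s_u'; apply: u'_out.
have st : s != t by rewrite -val_eqE neq_ltn lt_st.
pose v1 := u' - component s u' + c s.
have v1a : b v1 (a s) = -1.
  by rewrite /v1 bDl formBl component_a b_ca !eqxx subrr add0r.
have v1t : b v1 (a t) = 0.
  by rewrite /v1 bDl formBl component_a b_ca u't (negPf st) !mulr0n !subr0.
have N1 : -1 != 0 :> K by rewrite oppr_eq0 oner_eq0.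
have Xv1 : is_center v1.
  apply: (center_move _ s_u' _ (Xu' u'0)); last by rewrite /meets v1a N1.
  rewrite (_ : v1 - u' = c s - component s u').
    by apply: planeD; [apply: plane_c | apply/planeN/plane_component].
  by rewrite /v1 addrC addrA addKr addrC.
have Xv2 : is_center (v1 + a t).
  have [h Hh hE] := H_mixed lt_st.
  have -> : v1 + a t = h v1 by rewrite hE v1a v1t scale0r subr0 scaleN1r opprK.
  exact: center_img.
have Xv3 : is_center (u' + a t).
  apply: (@center_move s (v1 + a t)) => //.
  - rewrite opprD addrACA subrr addr0 /v1 opprD opprB addrA addrCA subrr addr0.
    by apply: planeD; [apply: plane_component | apply/planeN/plane_c].
  - by rewrite /meets bDl v1a b_aa addr0 N1.
  - by move: s_u'; rewrite /meets !bDl b_aa b_ac [t == s]eq_sym (negPf st) !addr0.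
apply: (@center_move t (u' + a t)) => //.
- rewrite /u' opprD opprB addrA addrCA subrr addr0.
  by apply: planeD; [apply: plane_component | apply/planeN/plane_a].
- by rewrite /meets [b _ (c t)]bDl b_ac eqxx u't add0r oner_eq0 orbT.
apply: contraNT w0; rewrite negb_or !negbK => /andP[/eqP ua /eqP uc].
by rewrite /w /component ua uc !scale0r subr0.
Qed.

Theorem isometries_generated : {subset isometries b <= H}.
Proof. by apply: transvections_generate => k v; apply: center_all. Qed.

End SymplecticGeneration.

(** * Superdeterminants *)

Section SuperDeterminant.

Variables (F : fieldType) (T : finType).
Implicit Types (M : T -> T -> F) (S : {set T}).

Definition kernel_mul M1 M2 : T -> T -> F :=
  fun x y => \sum_z M1 x z * M2 z y.

Definition det_on S M : F :=
  \det (\matrix_(i < #|S|, j < #|S|) M (enum_val i) (enum_val j)).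

Lemma det_on_mul S M M1 M2 :
    {in S &, forall x y, M x y = \sum_(z in S) M1 x z * M2 z y} ->
  det_on S M = det_on S M1 * det_on S M2.
Proof.
move=> M12; rewrite -det_mulmx; congr (\det _); apply/matrixP => i j.
rewrite !mxE M12 ?enum_valP // big_enum_val /=.
by apply: eq_bigr => k _; rewrite !mxE.
Qed.

Lemma det_on_diag S M (d : T -> F) :
    {in S &, forall x y, M x y = d x *+ (x == y)} ->
  det_on S M = \prod_(x in S) d x.
Proof.
move=> Md; rewrite /det_on [X in \det X](_ : _ = diag_mx (\row_i d (enum_val i))).
  by rewrite det_diag [RHS]big_enum_val /=; apply: eq_bigr => i _; rewrite mxE.
apply/matrixP => i j; rewrite !mxE Md ?enum_valP // (inj_eq enum_val_inj).
by rewrite eq_sym; case: eqP => // <-.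
Qed.

Variables (n : T -> T) (o : T).
Hypothesis nK : involutive n.
Hypothesis n_fix : forall x, (n x == x) = (x == o).

Definition even_kernel M := forall x y, M (n x) (n y) = M x y.

(** The enumeration of T serves to choose a point in each pair {x, n x}. *)
Definition reps : {set T} := [set x | (enum_rank x < enum_rank (n x))%N].

Lemma reps_o : o \notin reps.
Proof.
have /eqP no : n o == o by rewrite n_fix.
by rewrite inE no ltnn.
Qed.

Lemma reps_opp x : x != o -> (n x \in reps) = (x \notin reps).
Proof.
move=> xo; rewrite !inE nK -leqNgt [RHS]leq_eqVlt.
by rewrite (inj_eq (@ord_inj _)) (inj_eq enum_rank_inj) n_fix (negPf xo).
Qed.

Lemma sum_reps (f : T -> F) :
  \sum_x f x = f o + \sum_(x in reps) (f x + f (n x)).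
Proof.
rewrite (bigD1 o) //= (bigID (mem reps)) /= big_split /=; congr (_ + (_ + _)).
  by apply: eq_bigl => x; case: eqP => [->|] //=; rewrite (negPf reps_o).
rewrite (reindex_inj (inv_inj nK)) /=; apply: eq_bigl => x.
have /eqP no : n o == o by rewrite n_fix.
rewrite -{1}no (inj_eq (inv_inj nK)).
by case: eqVneq => [->|xo]; rewrite ?(negPf reps_o) // reps_opp ?negbK.
Qed.

(** The matrices of M on the span of the vectors v_o and v_x + v_(n x), and on
    the span of the vectors v_x - v_(n x). *)
Definition even_part M x y := if y == o then M x o else M x y + M x (n y).
Definition odd_part M x y := M x y - M x (n y).

(** In characteristic other than 2, the Berezinian of M for the grading by the
    eigenspaces of the involution. The even space has one dimension more than the
    odd one, so that this quotient recovers a scalar c from the operator c. *)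
Definition superdet M : F :=
  det_on (o |: reps) (even_part M) / det_on reps (odd_part M).

(** In the product of two kernels, the sum over T is grouped by the pairs
    {z, n z}: as a function of z, the even part of the second factor is
    symmetric and its odd part is antisymmetric. *)
Lemma superdet_mul M1 M2 : even_kernel M1 -> even_kernel M2 ->
  superdet (kernel_mul M1 M2) = superdet M1 * superdet M2.
Proof.
have /eqP no : n o == o by rewrite n_fix.
move=> e1 e2; rewrite /superdet mulrACA -invfM; congr (_ / _).
  apply: det_on_mul => x y _ _; rewrite big_setU1 ?reps_o //= {2}/even_part eqxx.
  have -> : even_part (kernel_mul M1 M2) x y = \sum_z M1 x z * even_part M2 z y.
    rewrite /even_part; case: eqP => // _; rewrite -big_split /=.
    by apply: eq_bigr => z _; rewrite mulrDr.
  rewrite sum_reps; congr (_ + _); apply: eq_bigr => z Nz.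
  have zo : z != o by apply: contraTneq Nz => ->; exact: reps_o.
  rewrite {3}/even_part (negPf zo) mulrDl; congr (_ + _ * _).
  rewrite /even_part; case: eqP => _; first by rewrite -{1}no e2.
  by rewrite e2 addrC -{2}(nK y) e2.
apply: det_on_mul => x y _ _.
have -> : odd_part (kernel_mul M1 M2) x y = \sum_z M1 x z * odd_part M2 z y.
  rewrite /odd_part -sumrB; by apply: eq_bigr => z _; rewrite mulrBr.
rewrite sum_reps {1}/odd_part -{3}no e2 subrr mulr0 add0r; apply: eq_bigr => z _.
rewrite {3}/odd_part mulrBl; congr (_ + _); rewrite -mulrN; congr (_ * _).
by rewrite /odd_part e2 -{1}(nK y) e2 opprB.
Qed.

Lemma reps_neq x y : x \in o |: reps -> y \in reps -> x != n y.
Proof.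
have /eqP no : n o == o by rewrite n_fix.
move=> Nx Ny; have yo : y != o by apply: contraTneq Ny => ->; exact: reps_o.
apply: contraTneq Nx => ->; rewrite in_setU1 reps_opp // Ny orbF.
by rewrite -{1}no (inj_eq (inv_inj nK)).
Qed.

(** The points of [reps] contribute alike to numerator and denominator. *)
Lemma superdet_diag M (d : T -> F) :
    (forall x y, M x y = d x *+ (x == y)) ->
    (forall x, d x != 0) ->
  superdet M = d o.
Proof.
move=> Md d0; rewrite /superdet.
rewrite (@det_on_diag _ _ d) => [|x y]; last first.
  rewrite /even_part !Md [y \in _]in_setU1; case: eqVneq => [->//|yo] /= Nx Ny.
  by rewrite (negPf (reps_neq Nx Ny)) mulr0n addr0.
rewrite (@det_on_diag _ _ d) => [|x y Nx Ny]; last first.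
  by rewrite /odd_part !Md (negPf (reps_neq (setU1r o Nx) Ny)) mulr0n subr0.
rewrite big_setU1 ?reps_o //= mulfK //.
by apply/prodf_neq0 => x _.
Qed.

Lemma card_reps : #|T| = (#|reps|.*2).+1.
Proof.
have Dreps : [set n x | x in reps] = ~: (o |: reps).
  apply/setP => x; rewrite -{1}(nK x) mem_imset; last exact: inv_inj.
  rewrite !inE negb_or; case: (eqVneq x o) => [->|xo] /=.
    by have /eqP no : n o == o; rewrite ?n_fix // !no ltnn.
  by have := reps_opp xo; rewrite !inE.
rewrite -(cardsC (o |: reps)) -Dreps card_imset; last exact: inv_inj.
by rewrite cardsU1 reps_o add1n addSn addnn.
Qed.

(** The involution is 1 on the even space and -1 on the odd space. *)
Lemma superdet_flip : superdet (fun x y => (x == n y)%:R) = (-1) ^+ #|reps|.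
Proof.
have /eqP no : n o == o by rewrite n_fix.
rewrite /superdet (@det_on_diag _ _ (fun=> 1)) => [|x y]; last first.
  rewrite /even_part nK [y \in _]in_setU1; case: (eqVneq y o) => [->|yo] /= Nx Ny.
    by rewrite no.
  by rewrite (negPf (reps_neq Nx Ny)) add0r.
rewrite (@det_on_diag _ _ (fun=> -1)) => [|x y Nx Ny]; last first.
  rewrite /odd_part nK (negPf (reps_neq (setU1r o Nx) Ny)) sub0r.
  by case: eqP => _; rewrite ?mulr1n ?mulr0n ?oppr0.
by rewrite big1 // prodr_const -signr_odd invr_sign mul1r signr_odd.
Qed.

End SuperDeterminant.

(** * Weil matrices of size r *)

Section WeilRepresentation.

Variables (F : fieldType) (m : nat) (theta : F).
Local Notation r := m.+2.
Hypothesis r_odd : odd r.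
Hypothesis theta_prim : r.-primitive_root theta.

Definition chi (x : 'I_r) : F := theta ^+ x.

Lemma chi_nat k : theta ^+ k = chi k%:R.
Proof. by rewrite /chi Zp_nat /= (prim_expr_mod theta_prim). Qed.

Lemma chiD (x y : 'I_r) : chi (x + y) = chi x * chi y.
Proof. by rewrite /chi -exprD -[RHS](prim_expr_mod theta_prim). Qed.

Lemma chi_mul (x y : 'I_r) : theta ^+ (x * y)%N = chi (x * y).
Proof. by rewrite chi_nat natrM !natr_Zp. Qed.

Lemma chi0 : chi 0 = 1.
Proof. exact: expr0. Qed.

Lemma chi_neq0 (x : 'I_r) : chi x != 0.
Proof. by rewrite expf_neq0 ?(theta_neq0 theta_prim). Qed.

Lemma sum_chi (x : 'I_r) : \sum_y chi (y * x) = r%:R *+ (x == 0).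
Proof.
rewrite -(theta_sum theta_prim x 0); apply: eq_bigr => y _.
by rewrite -chi_mul muln0 expr0 invr1 mulr1.
Qed.

Definition half_Zp : 'I_r := (r.+1./2)%:R.

Lemma half_Zp_double : half_Zp *+ 2 = 1.
Proof.
rewrite -mulrnA muln2 [_.*2](_ : _ = r.+1); last by move: r_odd; clear; lia.
by rewrite -natr1 (_ : r%:R = 0) ?add0r // Zp_nat; apply/val_inj; rewrite /= modnn.
Qed.

Lemma oppr_Zp_eq (x : 'I_r) : (- x == x) = (x == 0).
Proof.
apply/eqP/eqP => [xN|->]; last by rewrite oppr0.
have x2 : x *+ 2 = 0 by rewrite mulr2n -{1}xN addNr.
by rewrite -[x]mul1r -half_Zp_double mulrnAl -mulrnAr x2 mulr0.
Qed.

Definition quad (x : 'I_r) : 'I_r := half_Zp * (x * x).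

Lemma quadD (x y : 'I_r) : quad (x + y) = quad x + x * y + quad y.
Proof.
rewrite /quad -[x * y]mul1r -half_Zp_double.
by ring.
Qed.

Lemma quadN (x : 'I_r) : quad (- x) = quad x.
Proof. by rewrite /quad mulrNN. Qed.

(** The integer x (x + r) / 2 represents half the square of x modulo r. *)
Lemma chi_quad (x : 'I_r) : theta ^+ (x * (x + r))./2 = chi (quad x).
Proof.
rewrite chi_nat; congr chi.
have r0 : r%:R = 0 :> 'I_r by rewrite Zp_nat; apply/val_inj; rewrite /= modnn.
have ev : (((x * (x + r))./2).*2 = x * (x + r))%N.
  rewrite -[RHS]odd_double_half oddM oddD r_odd.
  by case: (odd x).
have e2 : ((x * (x + r))./2)%:R *+ 2 = x * x :> 'I_r.
  by rewrite -mulrnA muln2 ev natrM natrD !natr_Zp r0 addr0.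
by rewrite /quad -e2 mulrnAr -mulrnAl half_Zp_double mul1r.
Qed.

Local Notation mC := (mxC r theta).
Definition mxA : 'M[F]_r := \matrix_(i, j) (chi i *+ (i == j)).
Definition mxB : 'M[F]_r := \matrix_(i, j) (i == j + 1)%:R.
Definition mxU : 'M[F]_r := \matrix_(i, j) (chi (quad i) *+ (i == j)).
Definition mxP : 'M[F]_r := \matrix_(i, j) (i == - j)%:R.

Lemma mxCE i j : mC i j = chi (i * j).
Proof. by rewrite mxE chi_mul. Qed.

Lemma diag_mulmxE (d : 'I_r -> F) (M : 'M[F]_r) :
  (\matrix_(i, j) (d i *+ (i == j))) *m M = \matrix_(i, j) (d i * M i j).
Proof.
apply/matrixP => i j; rewrite !mxE (bigD1 i) //= big1 ?addr0 => [|k].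
  by rewrite mxE eqxx.
by rewrite mxE eq_sym => /negPf->; rewrite mul0r.
Qed.

Lemma mulmx_diagE (d : 'I_r -> F) (M : 'M[F]_r) :
  M *m (\matrix_(i, j) (d i *+ (i == j))) = \matrix_(i, j) (M i j * d j).
Proof.
apply/matrixP => i j; rewrite !mxE (bigD1 j) //= big1 ?addr0 => [|k].
  by rewrite mxE eqxx.
by rewrite mxE => /negPf->; rewrite mulr0.
Qed.

Lemma perm_mulmxE (f g : 'I_r -> 'I_r) (M : 'M[F]_r) :
    (forall i j, (i == f j) = (j == g i)) ->
  (\matrix_(i, j) (i == f j)%:R) *m M = \matrix_(i, j) M (g i) j.
Proof.
move=> fg; apply/matrixP => i j; rewrite !mxE (bigD1 (g i)) //= big1 ?addr0 => [|k].
  by rewrite mxE fg eqxx mul1r.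
by rewrite mxE fg => /negPf->; rewrite mul0r.
Qed.

Lemma mulmx_permE (f : 'I_r -> 'I_r) (M : 'M[F]_r) :
  M *m (\matrix_(i, j) (i == f j)%:R) = \matrix_(i, j) M i (f j).
Proof.
apply/matrixP => i j; rewrite !mxE (bigD1 (f j)) //= big1 ?addr0 => [|k].
  by rewrite mxE eqxx mulr1.
by rewrite mxE => /negPf->; rewrite mulr0.
Qed.

Let shiftE i j : (i == j + 1 :> 'I_r) = (j == i - 1).
Proof. by rewrite [RHS]eq_sym subr_eq. Qed.

Lemma mxBCA : mxB *m (mC *m mxA) = mC.
Proof.
rewrite mulmx_diagE (perm_mulmxE _ shiftE); apply/matrixP => i j.
by rewrite [LHS]mxE mxE !mxCE -chiD mulrBl mul1r subrK.
Qed.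

Lemma mxCB : mC *m mxB = mxA *m mC.
Proof.
rewrite mulmx_permE diag_mulmxE; apply/matrixP => i j.
by rewrite [LHS]mxE [RHS]mxE !mxCE -chiD mulrDr mulr1 addrC.
Qed.

Lemma mxUA : mxU *m mxA = mxA *m mxU.
Proof.
rewrite mulmx_diagE diag_mulmxE; apply/matrixP => i j; rewrite !mxE.
by case: eqP => [->|_]; rewrite ?mulr0 ?mul0r // mulrC.
Qed.

Lemma mxUB : mxU *m mxB = chi half_Zp *: (mxB *m (mxA *m mxU)).
Proof.
rewrite !diag_mulmxE (perm_mulmxE _ shiftE); apply/matrixP => i j; rewrite !mxE.
rewrite [in RHS]eq_sym -shiftE; case: eqP => [->|_]; last by rewrite !mulr0.
rewrite addrK !mulr1n mulr1 -!chiD; congr chi.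
by rewrite quadD /quad !mulr1 addrC; congr (_ + _); rewrite addrC.
Qed.

Lemma mxCC : mC *m mC = r%:R *: mxP.
Proof.
apply/matrixP => i j; rewrite !mxE -addr_eq0 -mulr_natr mul1r mulr_natr -sum_chi.
by apply: eq_bigr => k _; rewrite !mxCE -chiD [i * k]mulrC -mulrDr.
Qed.

Lemma mxPP : mxP *m mxP = 1%:M.
Proof.
rewrite mulmx_permE; apply/matrixP => i j; rewrite !mxE opprK.
by [].
Qed.

Definition gauss_sum : F := \sum_x chi (quad x).

(** Completing the square: quad k + k (i + j) = quad (k + i + j) - quad (i + j). *)
Lemma mxUCUC : (mxU *m mC) *m (mxU *m mC) =
  gauss_sum *: \matrix_(i, j) chi (- (i * j + quad j)).
Proof.
rewrite diag_mulmxE; apply/matrixP => i j; rewrite !mxE mulr_suml.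
rewrite (reindex_inj (addIr (- (i + j)))) /=; apply: eq_bigr => k _.
rewrite !mxE !chi_mul -!chiD; congr chi.
have -> : quad k = quad (k - (i + j)) + (k - (i + j)) * (i + j) + quad (i + j).
  by rewrite -quadD subrK.
rewrite (quadD i j); ring.
Qed.

(** With [mxC_four], these are the relations of SL_2(Z) between its elements of
    order 3 and 4, up to scalars. *)
Lemma mxUC_cube : (mxU *m mC) *m (mxU *m mC) *m (mxU *m mC) = (gauss_sum * r%:R)%:M.
Proof.
rewrite mxUCUC diag_mulmxE -scalemxAl; apply/matrixP => i j; rewrite !mxE.
rewrite -mulrnAr; congr (_ * _).
rewrite (_ : (i == j) = (j - i == 0)); last by rewrite subr_eq0 eq_sym.
rewrite -sum_chi; apply: eq_bigr => k _; rewrite !mxE !chi_mul -!chiD; congr chi.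
by ring.
Qed.

Lemma mxC_four : mC *m mC *m (mC *m mC) = (r%:R ^+ 2)%:M.
Proof.
by rewrite mxCC -scalemxAl -scalemxAr scalerA mxPP scalemx1 expr2.
Qed.

(** The determinant is chi of half the sum of all squares. Six times this sum is
    divisible by r; for r = 3 the sum itself is not, so the cube is essential. *)
Lemma det_mxU_cube : \det mxU ^+ 3 = 1.
Proof.
have -> : mxU = diag_mx (\row_i chi (quad i)).
  apply/matrixP => i j; rewrite !mxE; by case: eqP => // ->.
rewrite det_diag (eq_bigr (fun i => chi (quad i))) => [|i _]; last by rewrite mxE.
have sum_sq n : ((\sum_(i < n) i * i) * 6 + n * (3 * n) = n * (2 * n * n + 1))%N.
  elim: n => [|n IHn]; first by rewrite big_ord0.
  rewrite big_ord_recr /=; move: IHn; set S := (\sum_(i < n) _)%N => IHn.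
  by move: S IHn => S; nia.
have -> : \prod_i chi (quad i) = chi (\sum_i quad i).
  by rewrite (big_morph chi chiD chi0).
rewrite -exprM /quad -mulr_sumr.
have r0 : r%:R = 0 :> 'I_r by rewrite Zp_nat; apply/val_inj; rewrite /= modnn.
have : (\sum_(i : 'I_r) i * i) *+ 6 = 0 :> 'I_r.
  have /(congr1 (fun n => n%:R : 'I_r)) := sum_sq r.
  rewrite natrD !natrM r0 !mul0r addr0 natr_sum => S0.
  rewrite -mulr_natr -[RHS]S0; congr (_ * _); apply: eq_bigr => i _.
  by rewrite natrM !natr_Zp.
move=> S6; rewrite chi_nat natrM natr_Zp mulr_natr -mulrnAr.
have -> : half_Zp * ((\sum_i i * i) *+ 3) = half_Zp * half_Zp * ((\sum_i i * i) *+ 6).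
  by rewrite -[LHS]mul1r -half_Zp_double; ring.
by rewrite S6 mulr0 chi0.
Qed.

(** * The scalar lambda *)

Local Notation even_mx M :=
  (even_kernel (-%R : 'I_r -> 'I_r) (fun i j => fun_of_matrix M i j)).

Let NK : involutive (-%R : 'I_r -> 'I_r). Proof. exact: opprK. Qed.

Definition sdet_mx (M : 'M[F]_r) : F :=
  superdet (-%R : 'I_r -> 'I_r) 0 (fun i j => M i j).

Lemma even_mulmx (M N : 'M[F]_r) : even_mx M -> even_mx N -> even_mx (M *m N).
Proof.
move=> eM eN i j; rewrite !mxE (reindex_inj oppr_inj) /=.
by apply: eq_bigr => k _; rewrite eM eN.
Qed.

Lemma sdet_mulmx (M N : 'M[F]_r) : even_mx M -> even_mx N ->
  sdet_mx (M *m N) = sdet_mx M * sdet_mx N.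
Proof.
move=> eM eN; rewrite /sdet_mx -(superdet_mul NK oppr_Zp_eq eM eN); congr superdet.
by apply/funext => i; apply/funext => j; rewrite mxE.
Qed.

Lemma sdet_scalar_mx c : c != 0 -> sdet_mx c%:M = c.
Proof.
move=> c0; apply: (superdet_diag NK oppr_Zp_eq (d := fun=> c)) => // i j.
by rewrite mxE.
Qed.

Lemma sdet_mxP : sdet_mx mxP = (-1) ^+ (r.-1)./2.
Proof.
rewrite /sdet_mx (_ : (fun i j => mxP i j) = fun i j => (i == - j)%:R); last first.
  by apply/funext => i; apply/funext => j; rewrite mxE.
rewrite (superdet_flip _ NK oppr_Zp_eq); congr (_ ^+ _).
have /(congr1 predn) := card_reps NK oppr_Zp_eq.
by rewrite card_ord => ->; rewrite doubleK.
Qed.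

Lemma even_mxP : even_mx mxP.
Proof. by move=> i j; rewrite !mxE eqr_opp. Qed.

Lemma even_mxU : even_mx mxU.
Proof. by move=> i j; rewrite !mxE quadN eqr_opp. Qed.

Lemma even_mxC : even_mx mC.
Proof. by move=> i j; rewrite !mxCE mulrNN. Qed.

Lemma even_scalar_mx (c : F) : even_mx (c%:M : 'M[F]_r).
Proof. by move=> i j; rewrite !mxE eqr_opp. Qed.

Lemma sdet_mxU : sdet_mx mxU = 1.
Proof.
rewrite /sdet_mx (superdet_diag NK oppr_Zp_eq (d := fun i => chi (quad i))).
- by rewrite /quad !mulr0 chi0.
- by move=> i j; rewrite mxE.
by move=> i; apply: chi_neq0.
Qed.

Lemma r_neq0 : r%:R != 0 :> F.
Proof. exact: prim_root_natf_neq0 theta_prim. Qed.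

Local Notation d := (sdet_mx mC).

Lemma sdetC_sqr : d ^+ 2 = r%:R * (-1) ^+ (r.-1)./2.
Proof.
have eC := even_mxC; have eP := even_mxP; have er := even_scalar_mx r%:R.
rewrite expr2 -sdet_mulmx // mxCC -mul_scalar_mx sdet_mulmx // sdet_mxP.
by rewrite sdet_scalar_mx ?r_neq0.
Qed.

Lemma sdetC_neq0 : d != 0.
Proof.
have: d ^+ 2 != 0 by rewrite sdetC_sqr mulf_neq0 ?signr_eq0 ?r_neq0.
by rewrite expf_eq0.
Qed.

Local Notation rho := (gauss_sum * r%:R).

Lemma det_mxC_cube : \det mC ^+ 3 = rho ^+ r.
Proof.
have := congr1 determinant mxUC_cube; rewrite !det_mulmx det_scalar => <-.
by rewrite -[LHS]mul1r -det_mxU_cube; ring.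
Qed.

Lemma rho_neq0 : rho != 0.
Proof.
have : \det mC ^+ 3 != 0 by rewrite expf_eq0 -unitfE -unitmxE (mxC_unit theta_prim).
by rewrite det_mxC_cube expf_eq0.
Qed.

Lemma sdetC_cube : d ^+ 3 = rho.
Proof.
have eC := even_mxC; have eU := even_mxU.
have eUC := even_mulmx eU eC; have eUC2 := even_mulmx eUC eUC.
rewrite -[RHS](sdet_scalar_mx rho_neq0) -mxUC_cube !sdet_mulmx // sdet_mxU !mul1r.
by ring.
Qed.

Lemma sdetC_four : d ^+ 4 = r%:R ^+ 2.
Proof.
by rewrite (exprM d 2 2) sdetC_sqr exprMn -exprM mulnC exprM sqrrN !expr1n mulr1.
Qed.

(** Both sides are nonzero, with the same third and fourth powers. *)
Lemma det_mxC : \det mC = d ^+ r.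
Proof.
have d0 := sdetC_neq0.
have C4 : \det mC ^+ 4 = (d ^+ r) ^+ 4.
  have := congr1 determinant mxC_four.
  by rewrite !det_mulmx det_scalar -sdetC_four -!exprM mulnC => <-; ring.
have C3 : \det mC ^+ 3 = (d ^+ r) ^+ 3.
  by rewrite det_mxC_cube -sdetC_cube -!exprM mulnC.
apply: (@mulIf _ (\det mC ^+ 3)); first by rewrite C3 !expf_neq0.
by rewrite -exprS C4 C3 -exprS.
Qed.

(** With r = 2k + 1 and d ^ 2 = (-1) ^ k r one has d ^ r = (- r) ^ k d, because
    k * k and k have the same parity. *)
Lemma lambda_sdetC : lambda r theta * d = 1.
Proof.
have d0 := sdetC_neq0.
rewrite /lambda det_mxC; set k := (r.-1)./2.
have rk : r = (2 * k).+1 by rewrite /k; move: r_odd; clear; lia.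
have kk : (-1) ^+ k ^+ k = (-1) ^+ k :> F.
  by rewrite -exprM -signr_odd oddM andbb signr_odd.
have -> : d ^+ r = (- r%:R) ^+ k * d.
  transitivity (d ^+ (2 * k).+1); first by rewrite -rk.
  rewrite exprSr exprM sdetC_sqr -/k.
  by rewrite exprMn kk [in RHS]exprNn [_ ^+ k * _]mulrC.
have rk0 : (- r%:R) ^+ k != 0 :> F by rewrite expf_neq0 // oppr_eq0 r_neq0.
by move: (_ ^+ k) d rk0 d0 => x y x0 y0; rewrite invfM mulrA mulfV // mul1r mulVf.
Qed.

(** * Operators on one tensor factor *)

Variable l : nat.
Local Notation W := (W F r l).
Local Notation idx := (label r l).
Implicit Types (s t u : 'I_l) (M N : 'M[F]_r) (xi eta : idx) (w : W).

Lemma ordSE (i : 'I_r) : ordS i = i + 1.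
Proof. by apply/val_inj; rewrite /= modnDmr addn1. Qed.

(** M acting on the t-th factor of W, seen as a tensor power of the space with
    basis v_0, ..., v_(r - 1). *)
Definition loc t M : 'End(W) :=
  endo (fun xi : idx => \sum_i M i (xi t) *: basis_vec (replace xi t i)).

Lemma loc_basis t M xi :
  loc t M (basis_vec xi) = \sum_i M i (xi t) *: basis_vec (replace xi t i).
Proof. exact: endoE. Qed.

Lemma loc_mul t M N w : loc t M (loc t N w) = loc t (M *m N) w.
Proof.
rewrite -comp_lfunE; apply: basisP w => xi; rewrite comp_lfunE !loc_basis linear_sum.
transitivity (\sum_j \sum_i (M i j * N j (xi t)) *: (basis_vec (replace xi t i) : W)).
  apply: eq_bigr => j _; rewrite linearZ /= loc_basis scaler_sumr.
  by apply: eq_bigr => i _; rewrite scalerA replaceE replace_replace mulrC.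
by rewrite exchange_big; apply: eq_bigr => i _; rewrite mxE scaler_suml.
Qed.

Lemma replaceC (xi : idx) s t i j : s != t ->
  replace (replace xi s i) t j = replace (replace xi t j) s i.
Proof.
move=> /negPf st; apply/ffunP => u; rewrite !ffunE.
by case: (eqVneq u s) => // ->; rewrite st.
Qed.

Lemma replace_neq (xi : idx) s t i : s != t -> replace xi s i t = xi t.
Proof. by rewrite eq_sym ffunE => /negPf->. Qed.

Lemma locC s t M N w : s != t -> loc s M (loc t N w) = loc t N (loc s M w).
Proof.
move=> st; have ts : t != s by rewrite eq_sym.
rewrite -!comp_lfunE; apply: basisP w => xi.
rewrite !comp_lfunE !loc_basis !linear_sum /=.
transitivity (\sum_j \sum_i (N j (xi t) * M i (xi s)) *:
    (basis_vec (replace (replace xi t j) s i) : W)).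
  apply: eq_bigr => j _; rewrite linearZ /= loc_basis scaler_sumr.
  by apply: eq_bigr => i _; rewrite scalerA replace_neq.
rewrite exchange_big; apply: eq_bigr => i _; rewrite linearZ /= loc_basis scaler_sumr.
by apply: eq_bigr => j _; rewrite scalerA replace_neq // mulrC replaceC.
Qed.

Lemma loc_diag_basis t M (d : 'I_r -> F) xi :
    (forall i j, M i j = d i *+ (i == j)) ->
  loc t M (basis_vec xi) = d (xi t) *: basis_vec xi.
Proof.
move=> Md; rewrite loc_basis (bigD1 (xi t)) //= big1 ?addr0 => [|i /negPf i_neq].
  by rewrite Md eqxx replace_id.
by rewrite Md i_neq scale0r.
Qed.

Lemma loc_scalar t (c : F) w : loc t c%:M w = c *: w.
Proof.
rewrite -[w in RHS]id_lfunE -scale_lfunE; apply: basisP w => xi.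
rewrite (@loc_diag_basis _ _ (fun=> c)) ?scale_lfunE ?id_lfunE // => i j.
by rewrite mxE.
Qed.

Lemma locZ t (c : F) M w : loc t (c *: M) w = c *: loc t M w.
Proof. by rewrite -mul_scalar_mx -loc_mul loc_scalar. Qed.

Lemma opA_loc t w : opA r theta t w = loc t mxA w.
Proof.
apply: basisP w => xi; rewrite endoE (@loc_diag_basis _ _ chi) // => i j.
by rewrite mxE.
Qed.

Lemma opB_loc t w : @opB F r l t w = loc t mxB w.
Proof.
apply: basisP w => xi; rewrite endoE loc_basis.
rewrite ordSE (bigD1 (xi t + 1)) //= big1 ?addr0 => [|i /negPf i_neq].
  by rewrite mxE eqxx scale1r.
by rewrite mxE i_neq scale0r.
Qed.

Lemma opC_loc t w : opC r theta t w = loc t (mxC r theta) w.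
Proof.
apply: basisP w => xi; rewrite endoE loc_basis.
by apply: eq_bigr => i _; rewrite mxE.
Qed.

Lemma opU_loc t w : opU r theta t w = loc t mxU w.
Proof.
apply: basisP w => xi; rewrite endoE chi_quad.
by rewrite (@loc_diag_basis _ _ (fun i => chi (quad i))) // => i j; rewrite mxE.
Qed.

(** * Superdeterminants of the generators of G *)

Definition kernel_of (g : 'End(W)) : idx -> idx -> F :=
  fun eta xi => g (basis_vec xi) eta.

Definition neg_label (xi : idx) : idx := [ffun s => - xi s].
Definition label0 : idx := [ffun=> 0].

Lemma neg_labelK : involutive neg_label.
Proof. by move=> xi; apply/ffunP => s; rewrite !ffunE opprK. Qed.

Lemma neg_label_fix xi : (neg_label xi == xi) = (xi == label0).
Proof.
apply/eqP/eqP => [/ffunP xiN|->].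
  apply/ffunP => s; have := xiN s; rewrite !ffunE => /eqP.
  by rewrite oppr_Zp_eq => /eqP.
by apply/ffunP => s; rewrite !ffunE oppr0.
Qed.

Lemma kernel_of_comp (f g : 'End(W)) :
  kernel_of (f \o g)%VF = kernel_mul (kernel_of f) (kernel_of g).
Proof.
apply/funext => eta; apply/funext => xi; rewrite /kernel_of /kernel_mul comp_lfunE.
rewrite {1}(basis_sum (g _)) linear_sum sum_ffunE.
by apply: eq_bigr => zeta _; rewrite linearZ ffunE mulrC.
Qed.

Definition sdet (g : 'End(W)) : F := superdet neg_label label0 (kernel_of g).

Definition opP : 'End(W) := endo (fun xi : idx => basis_vec (neg_label xi)).

Lemma opPE w eta : opP w eta = w (neg_label eta).
Proof.
rewrite {1}(basis_sum w) linear_sum sum_ffunE (bigD1 (neg_label eta)) //=.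
rewrite big1 ?addr0 => [|xi neq].
  by rewrite linearZ /= endoE !ffunE neg_labelK eqxx [LHS]mulr1.
rewrite linearZ /= endoE !ffunE -(inj_eq (inv_inj neg_labelK)) neg_labelK eq_sym.
by rewrite (negPf neq) [LHS]mulr0.
Qed.

Definition commP (g : 'End(W)) := forall w, g (opP w) = opP (g w).

Lemma commP_even g : commP g -> even_kernel neg_label (kernel_of g).
Proof. by move=> gP eta xi; rewrite /kernel_of -opPE -gP endoE neg_labelK. Qed.

Lemma commP_basis (g : 'End(W)) :
  (forall xi, g (basis_vec (neg_label xi)) = opP (g (basis_vec xi))) -> commP g.
Proof.
move=> gP w; rewrite -!comp_lfunE; apply: basisP w => xi.
by rewrite !comp_lfunE endoE gP.
Qed.

Lemma sdet_comp f g : commP f -> commP g -> sdet (f \o g)%VF = sdet f * sdet g.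
Proof.
move=> /commP_even ef /commP_even eg.
by rewrite /sdet kernel_of_comp (superdet_mul neg_labelK neg_label_fix).
Qed.

Lemma commP_comp f g : commP f -> commP g -> commP (f \o g)%VF.
Proof. by move=> fP gP w; rewrite !comp_lfunE gP fP. Qed.

Lemma sdet_diag (g : 'End(W)) (d : idx -> F) :
    (forall xi, g (basis_vec xi) = d xi *: basis_vec xi) -> (forall xi, d xi != 0) ->
  sdet g = d label0.
Proof.
move=> gd d0; apply: (superdet_diag neg_labelK neg_label_fix) d0 => eta xi.
rewrite /kernel_of gd !ffunE; case: eqP => [->|_]; first by rewrite [LHS]mulr1.
by rewrite [LHS]mulr0.
Qed.

Lemma commP_diag (g : 'End(W)) (d : idx -> F) :
    (forall xi, g (basis_vec xi) = d xi *: basis_vec xi) ->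
    (forall xi, d (neg_label xi) = d xi) -> commP g.
Proof. by move=> gd dN; apply: commP_basis => xi; rewrite !gd linearZ /= endoE dN. Qed.

Lemma sdet_scalar (c : F) : c != 0 -> sdet (c *: \1%VF) = c.
Proof.
move=> c0; apply: (@sdet_diag _ (fun=> c)) => // xi.
by rewrite scale_lfunE id_lfunE.
Qed.

Lemma commP_loc t M : even_kernel -%R (fun i j => M i j) -> commP (loc t M).
Proof.
move=> eM; apply: commP_basis => xi; rewrite !loc_basis linear_sum /=.
rewrite (reindex_inj oppr_inj) /=; apply: eq_bigr => i _.
rewrite linearZ /= endoE ffunE eM; congr (_ *: basis_vec _).
by apply/ffunP => s; rewrite !ffunE; case: eqP.
Qed.

Lemma opC_comm t : commP (opC r theta t).
Proof.
by move=> w; rewrite !opC_loc; apply: commP_loc; apply: even_mxC.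
Qed.

Lemma opU_basis t xi : opU r theta t (basis_vec xi) =
  chi (quad (xi t)) *: (basis_vec xi : W).
Proof. by rewrite endoE chi_quad. Qed.

Lemma opU_comm t : commP (opU r theta t).
Proof.
by apply: (commP_diag (opU_basis t)) => xi; rewrite ffunE quadN.
Qed.

Lemma sdet_opU t : sdet (opU r theta t) = 1.
Proof.
rewrite (sdet_diag (opU_basis t)) => [|xi]; first by rewrite ffunE /quad !mulr0 chi0.
exact: chi_neq0.
Qed.

Lemma opD_basis s t xi : opD r theta s t (basis_vec xi) =
  chi (xi s * xi t) *: (basis_vec xi : W).
Proof. by rewrite endoE chi_mul. Qed.

Lemma opD_comm s t : commP (opD r theta s t).
Proof. by apply: (commP_diag (opD_basis s t)) => xi; rewrite !ffunE mulrNN. Qed.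

Lemma sdet_opD s t : sdet (opD r theta s t) = 1.
Proof.
rewrite (sdet_diag (opD_basis s t)) => [|xi]; first by rewrite !ffunE mulr0 chi0.
exact: chi_neq0.
Qed.

Lemma sdet_loc_mul t (M N : 'M[F]_r) : even_mx M -> even_mx N ->
  sdet (loc t (M *m N)) = sdet (loc t M) * sdet (loc t N).
Proof.
move=> eM eN; rewrite -sdet_comp //; try exact: commP_loc.
by congr sdet; apply/lfunP => w; rewrite comp_lfunE loc_mul.
Qed.

Lemma sdet_loc_scalar t (c : F) : c != 0 -> sdet (loc t (c%:M : 'M[F]_r)) = c.
Proof.
move=> c0; rewrite -[RHS](sdet_scalar c0); congr sdet; apply/lfunP => w.
by rewrite loc_scalar scale_lfunE id_lfunE.
Qed.

(** The relations between C and U pass to their actions on the t-th factor, so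
    the two superdeterminants have the same third and fourth powers. *)
Lemma sdet_opC t : sdet (opC r theta t) = sdet_mx mC.
Proof.
have eC := even_mxC; have eU := even_mxU.
have eUC := even_mulmx eU eC; have eUC2 := even_mulmx eUC eUC.
have locE M (g : 'End(W)) : (forall w, g w = loc t M w) -> loc t M = g.
  by move=> gM; apply/lfunP => w; rewrite gM.
have sU : sdet (loc t mxU) = 1.
  by rewrite (locE _ _ (opU_loc t)) sdet_opU.
rewrite -(locE _ _ (opC_loc t)); set D := sdet _; set d := sdet_mx mC.
have D3 : D ^+ 3 = d ^+ 3.
  rewrite /d sdetC_cube -[RHS](sdet_loc_scalar t rho_neq0) -mxUC_cube.
  rewrite !sdet_loc_mul //.
  by rewrite sU !mul1r -/D; ring.
have D4 : D ^+ 4 = d ^+ 4.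
  have r2 : r%:R ^+ 2 != 0 :> F by rewrite expf_neq0 // r_neq0.
  rewrite /d sdetC_four -[RHS](sdet_loc_scalar t r2) -mxC_four.
  have eCC := even_mulmx eC eC.
  by rewrite !sdet_loc_mul // -/D; ring.
have d0 := sdetC_neq0.
apply: (@mulIf _ (d ^+ 3)); first by rewrite expf_neq0.
by rewrite -{1}D3 -!exprS D4.
Qed.

Lemma sdet_lambdaC t : sdet (lambda r theta *: opC r theta t) = 1.
Proof.
have l0 := lambda_neq0 theta_prim.
have -> : lambda r theta *: opC r theta t =
    ((lambda r theta *: \1) \o opC r theta t)%VF.
  by apply/lfunP => w; rewrite comp_lfunE !scale_lfunE id_lfunE.
rewrite sdet_comp //; last exact: opC_comm.
  by rewrite sdet_opC sdet_scalar // lambda_sdetC.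
by move=> w; rewrite !scale_lfunE !id_lfunE linearZ.
Qed.

(** * The action of the generators on R *)

Hypothesis r_prime : prime r.
Hypothesis l_gt0 : (0 < l)%N.

Local Notation A := (glA theta_prim).
Local Notation B := (@glB F r l).
Local Notation C := (gl_lambdaC theta_prim).
Local Notation D := (glD theta_prim).
Local Notation U := (glU theta_prim).
Local Notation G := (G l theta_prim).
Local Notation R := (R l theta_prim).
Local Notation Rt := (subg_type R).
Local Notation normR := (normR l theta_prim).
Local Notation Q := (Rbar l theta_prim r_prime).
Local Notation cl := (@coset_of_R F r l theta r_prime theta_prim).
Local Notation rA t := (Rgen_A theta_prim t).
Local Notation rB t := (Rgen_B theta_prim t).
Local Notation a t := (cl (rA t)).
Local Notation b t := (cl (rB t)).
Local Notation form := (@comm_form F r l theta r_prime theta_prim).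

Lemma glA_loc t w : A t w = loc t mxA w.
Proof. exact: opA_loc. Qed.
Lemma glB_loc t w : B t w = loc t mxB w.
Proof. exact: opB_loc. Qed.
Lemma glC_loc t w : C t w = lambda r theta *: loc t (mxC r theta) w.
Proof. by rewrite scale_lfunE opC_loc. Qed.
Lemma glU_loc t w : U t w = loc t mxU w.
Proof. exact: opU_loc. Qed.

Lemma C_A t w : B t (C t (A t w)) = C t w.
Proof.
by rewrite glA_loc !glC_loc glB_loc linearZ /= !loc_mul -mulmxA mxBCA.
Qed.

Lemma C_B t w : C t (B t w) = A t (C t w).
Proof.
by rewrite glA_loc glB_loc !glC_loc linearZ /= !loc_mul mxCB.
Qed.

Lemma C_A_neq s t w : s != t -> C s (A t w) = A t (C s w).
Proof. by move=> st; rewrite !glA_loc !glC_loc linearZ /= locC. Qed.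

Lemma C_B_neq s t w : s != t -> C s (B t w) = B t (C s w).
Proof. by move=> st; rewrite !glB_loc !glC_loc linearZ /= locC. Qed.

Lemma U_A s t w : U s (A t w) = A t (U s w).
Proof.
rewrite !glA_loc !glU_loc; have [->|st] := eqVneq s t; last by rewrite locC.
by rewrite !loc_mul mxUA.
Qed.

Lemma U_B t w : U t (B t w) = chi half_Zp *: B t (A t (U t w)).
Proof.
by rewrite !glA_loc !glB_loc !glU_loc !loc_mul -mulmxA mxUB locZ.
Qed.

Lemma U_B_neq s t w : s != t -> U s (B t w) = B t (U s w).
Proof. by move=> st; rewrite !glB_loc !glU_loc locC. Qed.

Lemma glA_basis t xi : A t (basis_vec xi) = chi (xi t) *: basis_vec xi.
Proof. exact: endoE. Qed.

Lemma glB_basis t xi : B t (basis_vec xi) = basis_vec (replace xi t (ordS (xi t))).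
Proof. exact: endoE. Qed.

Lemma glD_basis s t xi : D s t (basis_vec xi) =
  chi (xi s * xi t) *: (basis_vec xi : W).
Proof. exact: opD_basis. Qed.

Lemma GL_basisP (g h : GL W) :
  (forall xi, g (basis_vec xi) = h (basis_vec xi)) -> forall w, g w = h w.
Proof. exact: basisP. Qed.

Lemma D_A s t u w : D s t (A u w) = A u (D s t w).
Proof.
rewrite -!GLM; apply: GL_basisP w => xi.
rewrite !GLM !(glA_basis, glD_basis) !linearZ /= !(glA_basis, glD_basis).
by rewrite !scalerA mulrC.
Qed.

Lemma D_Bl s t w : s != t -> D s t (B s w) = B s (A t (D s t w)).
Proof.
move=> st; rewrite -!GLM; apply: GL_basisP w => xi.
rewrite !GLM glB_basis !glD_basis !linearZ /= glA_basis !linearZ /= glB_basis scalerA.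
rewrite replaceE replace_neq // ordSE -chiD; congr (chi _ *: _).
by rewrite mulrDl mul1r addrC.
Qed.

Lemma D_Br s t w : s != t -> D s t (B t w) = B t (A s (D s t w)).
Proof.
move=> st; have ts : t != s by rewrite eq_sym.
rewrite -!GLM; apply: GL_basisP w => xi.
rewrite !GLM glB_basis !glD_basis !linearZ /= glA_basis !linearZ /= glB_basis scalerA.
rewrite replaceE replace_neq // ordSE -chiD; congr (chi _ *: _).
by rewrite mulrDr mulr1 addrC.
Qed.

Lemma D_B_neq s t u w : u != s -> u != t -> D s t (B u w) = B u (D s t w).
Proof.
move=> us ut; rewrite -!GLM; apply: GL_basisP w => xi.
by rewrite !GLM glB_basis !glD_basis !linearZ /= glB_basis !replace_neq.
Qed.

(** The commutator of A_t and B_t is the scalar theta; this is where l > 0 enters. *)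
Lemma scalar_in_R k : exists2 z : GL W, z \in R & forall w, z w = theta ^+ k *: w.
Proof.
pose t := Ordinal l_gt0; pose x := Rgen_A theta_prim t; pose y := Rgen_B theta_prim t.
exists (val [~ x, y]%g ^+ k)%g; first by apply: gpredXn; apply: valP.
have zE w : (val [~ x, y]%g : GL W) w = theta *: w.
  rewrite (comm_formP r_prime) scale_lfunE id_lfunE (comm_form_AB r_prime) eqxx.
  by rewrite (theta_Fp r_prime theta_prim 1) expr1.
move=> w; elim: k => [|k IHk]; first by rewrite GL1 scale1r.
by rewrite expgS GLM IHk zE scalerA exprS.
Qed.

(** Conjugation by g takes y to x, up to an element of Z(R). *)
Definition conj_rel (g y x : GL W) :=
  exists k, forall w, g (y w) = theta ^+ k *: x (g w).

Lemma GLK (g : GL W) w : g ((g^-1)%g w) = w.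
Proof. by rewrite -GLM mulgV GL1. Qed.
Lemma GLVK (g : GL W) w : (g^-1)%g (g w) = w.
Proof. by rewrite -GLM mulVg GL1. Qed.

(** The first two conditions put the conjugate of R by g inside R, and the last
    two do so for the inverse of g. *)
Lemma normR_intro (g : GL W) :
    (forall t, exists2 x, x \in R & conj_rel g (A t) x) ->
    (forall t, exists2 x, x \in R & conj_rel g (B t) x) ->
    (forall t, exists2 y, y \in R & conj_rel g y (A t)) ->
    (forall t, exists2 y, y \in R & conj_rel g y (B t)) ->
  g \in normR.
Proof.
move=> gA gB gA' gB'.
have conj y x : conj_rel g y x -> exists2 z, z \in R & (g * y = z * x * g)%g.
  case=> k gk; have [z Rz zE] := scalar_in_R k; exists z => //.
  by apply/GLP => w; rewrite !GLM zE gk.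
have conj_to (y x : GL W) : x \in R -> conj_rel g y x -> (g * y * g^-1)%g \in R.
  by move=> Rx /conj[z Rz ->]; rewrite mulgK; apply: gpredM.
have conj_from (y x : GL W) : y \in R -> conj_rel g y x -> (g^-1 * x * g)%g \in R.
  move=> Ry [k gk]; have [z Rz zE] := scalar_in_R k.
  have -> : (g^-1 * x * g = z^-1 * y)%g.
    apply: (canRL (mulKg _)); apply/GLP => w; rewrite !GLM zE.
    by rewrite -linearZ /= -gk GLVK.
  by rewrite gpredM ?gpredV.
have R_to : {in R, forall x, (g * x * g^-1)%g \in R}.
  apply: R_ind => [t|t||x y Rx Ry|x Rx].
  - by have [x Rx] := gA t; apply: conj_to.
  - by have [x Rx] := gB t; apply: conj_to.
  - by rewrite mulg1 mulgV gpred1.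
  - have -> : (g * (x * y) * g^-1 = (g * x * g^-1) * (g * y * g^-1))%g.
      by rewrite !mulgA mulgVK.
    exact: gpredM.
  have -> : (g * x^-1 * g^-1 = (g * x * g^-1)^-1)%g by rewrite !invgM invgK mulgA.
  by rewrite gpredV.
have R_from : {in R, forall x, (g^-1 * x * g)%g \in R}.
  apply: R_ind => [t|t||x y Rx Ry|x Rx].
  - by have [x Rx] := gA' t; apply: conj_from.
  - by have [x Rx] := gB' t; apply: conj_from.
  - by rewrite mulg1 mulVg gpred1.
  - have -> : (g^-1 * (x * y) * g = (g^-1 * x * g) * (g^-1 * y * g))%g.
      by rewrite !mulgA mulgK.
    exact: gpredM.
  have -> : (g^-1 * x^-1 * g = (g^-1 * x * g)^-1)%g by rewrite !invgM invgK mulgA.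
  by rewrite gpredV.
apply/normaliserP => x; apply/idP/idP => [/R_from|/R_to //].
by rewrite !mulgA mulVg mul1g mulgVK.
Qed.

Lemma conj_rel_eq (g y x : GL W) : (forall w, g (y w) = x (g w)) -> conj_rel g y x.
Proof. by move=> E; exists 0%N => w; rewrite scale1r E. Qed.

Local Notation RA := (glA_R theta_prim).
Local Notation RB := (glB_R theta_prim).

Lemma C_normR t : C t \in normR.
Proof.
apply: normR_intro => s; have [<-|ts] := eqVneq t s.
- exists (B t)^-1%g; first by rewrite gpredV RB.
  by apply: conj_rel_eq => w; rewrite -(C_A t w) GLVK.
- by exists (A s); [apply: RA | apply: conj_rel_eq => w; apply: C_A_neq].
- by exists (A t); [apply: RA | apply: conj_rel_eq => w; apply: C_B].
- by exists (B s); [apply: RB | apply: conj_rel_eq => w; apply: C_B_neq].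
- by exists (B t); [apply: RB | apply: conj_rel_eq => w; apply: C_B].
- by exists (A s); [apply: RA | apply: conj_rel_eq => w; apply: C_A_neq].
- exists (A t)^-1%g; first by rewrite gpredV RA.
  by apply: conj_rel_eq => w; rewrite -{2}(GLK (A t) w) C_A.
- by exists (B s); [apply: RB | apply: conj_rel_eq => w; apply: C_B_neq].
Qed.

Lemma U_normR t : U t \in normR.
Proof.
apply: normR_intro => s.
- by exists (A s); [apply: RA | apply: conj_rel_eq => w; apply: U_A].
- have [<-|ts] := eqVneq t s.
    exists (B t * A t)%g; first by rewrite gpredM ?RA ?RB.
    by exists half_Zp => w; rewrite U_B GLM.
  by exists (B s); [apply: RB | apply: conj_rel_eq => w; apply: U_B_neq].
- by exists (A s); [apply: RA | apply: conj_rel_eq => w; apply: U_A].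
have [<-|ts] := eqVneq t s.
  exists (B t * (A t)^-1)%g; first by rewrite gpredM ?gpredV ?RA ?RB.
  by exists half_Zp => w; rewrite GLM U_B -U_A GLK.
by exists (B s); [apply: RB | apply: conj_rel_eq => w; apply: U_B_neq].
Qed.

Lemma D_normR s t : s != t -> D s t \in normR.
Proof.
move=> st; apply: normR_intro => u.
- by exists (A u); [apply: RA | apply: conj_rel_eq => w; apply: D_A].
- have [->|us] := eqVneq u s.
    exists (B s * A t)%g; first by rewrite gpredM ?RA ?RB.
    by apply: conj_rel_eq => w; rewrite D_Bl // GLM.
  have [->|ut] := eqVneq u t.
    exists (B t * A s)%g; first by rewrite gpredM ?RA ?RB.
    by apply: conj_rel_eq => w; rewrite D_Br // GLM.
  by exists (B u); [apply: RB | apply: conj_rel_eq => w; apply: D_B_neq].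
- by exists (A u); [apply: RA | apply: conj_rel_eq => w; apply: D_A].
have [->|us] := eqVneq u s.
  exists (B s * (A t)^-1)%g; first by rewrite gpredM ?gpredV ?RA ?RB.
  by apply: conj_rel_eq => w; rewrite GLM D_Bl // -D_A GLK.
have [->|ut] := eqVneq u t.
  exists (B t * (A s)^-1)%g; first by rewrite gpredM ?gpredV ?RA ?RB.
  by apply: conj_rel_eq => w; rewrite GLM D_Br // -D_A GLK.
by exists (B u); [apply: RB | apply: conj_rel_eq => w; apply: D_B_neq].
Qed.

Lemma G_normR : {subset G <= normR}.
Proof.
move=> g /generatedP Gg; apply: (Gg (normR)) => x.
case/or3P => [/existsP[t /eqP->]||/existsP[t /eqP->]].
- exact: C_normR.
- case/existsP => s /existsP[t /andP[st /eqP->]].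
  by apply: D_normR; rewrite -val_eqE neq_ltn st.
exact: U_normR.
Qed.

Lemma coset_eq_scaled (x y : Rt) (c : F) :
  (forall w, (val x : GL W) w = c *: (val y : GL W) w) -> cl x = cl y.
Proof.
move=> xy; apply/clP => z; rewrite -[RHS]natr_Zp.
apply: (qcomm_unique r_prime) => w.
rewrite !xy linearZ /= (qcomm_e r_prime y z) !scalerA.
by rewrite mulrC.
Qed.

Lemma pi_Sp_eq (g : subg_type (normR)) (x y : Rt) (c : F) :
    (forall w, (val g : GL W) ((val x : GL W) w) =
               c *: (val y : GL W) ((val g : GL W) w)) ->
  val (pi_Sp r_prime g) (cl x) = cl y.
Proof.
move=> gxy; rewrite pi_Sp_cl; apply: (@coset_eq_scaled _ _ c) => w.
by rewrite SubK !GLM gxy GLK.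
Qed.

Lemma Q_ext (f g : Q -> Q) : linear f -> linear g ->
  (forall t, f (a t) = g (a t)) -> (forall t, f (b t) = g (b t)) -> f =1 g.
Proof.
move=> f_lin g_lin fga fgb u.
have f0 (h : Q -> Q) : linear h -> h 0 = 0.
  by move=> /(_ (-1) 0 0); rewrite scaler0 addr0 scaleN1r addNr.
have ext k v v' : f v = g v -> f v' = g v' -> f (k *: v + v') = g (k *: v + v').
  by move=> fgv fgw; rewrite f_lin g_lin fgv fgw.
have -> : u = of_coords r_prime theta_prim (coords u).
  by rewrite (inj_can_sym (of_coordsK r_prime theta_prim) (@coords_inj _ _ _ _ _ _)).
rewrite /of_coords; elim/big_rec: _ => [|t v _ fgv]; first by rewrite !f0.
by rewrite -addrA; apply: (ext) => //; rewrite -scaleNr; apply: (ext).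
Qed.

(** * Injectivity *)

Lemma chi_inj : injective chi.
Proof.
move=> i j /eqP; rewrite (eq_prim_root_expr theta_prim) => /eqP.
by rewrite !modn_small // => /val_inj.
Qed.

Lemma label_spread (X : Type) (c : label r l -> X) :
    (forall xi t, c (replace xi t (xi t + 1)) = c xi) ->
  forall xi, c xi = c label0.
Proof.
move=> c1.
have cn xi t n : c (replace xi t (xi t + n%:R)) = c xi.
  elim: n => [|n IHn]; first by rewrite addr0 replace_id.
  by rewrite -IHn -[RHS](c1 _ t) replace_replace replaceE -addrA natr1.
have ci xi t i : c (replace xi t i) = c xi.
  by rewrite -(cn xi t (i - xi t)) natr_Zp addrC subrK.
suff H (s : seq 'I_l) (xi : label r l) :
    (forall t, t \notin s -> xi t = 0) -> c xi = c label0.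
  by move=> xi; apply: (H (enum 'I_l)) => t; rewrite mem_enum.
elim: s xi => [|t s IHs] xi xi0.
  by congr c; apply/ffunP => t; rewrite ffunE xi0.
rewrite -(ci xi t 0); apply: IHs => u su; rewrite ffunE; case: eqVneq => // ut.
by apply: xi0; rewrite inE negb_or ut.
Qed.

Lemma GLZ (g : GL W) (k : F) w : g (k *: w) = k *: g w.
Proof. by rewrite linearZ. Qed.

Lemma W_scaleE (k : F) w eta : (k *: w) eta = k * w eta.
Proof. by rewrite ffunE. Qed.

Lemma A_apply t w eta : A t w eta = chi (eta t) * w eta.
Proof.
have AZ k v : A t (k *: v) = k *: A t v by rewrite linearZ.
rewrite {1}(basis_sum w) linear_sum sum_ffunE (bigD1 eta) //= big1 ?addr0 => [|xi neq].
  by rewrite AZ glA_basis !W_scaleE ffunE eqxx mulr1 mulrC.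
by rewrite AZ glA_basis !W_scaleE ffunE eq_sym (negPf neq) !mulr0.
Qed.

(** The joint eigenspaces of the A_t are the lines spanned by the v_xi, and the
    B_t permute these lines transitively. *)
Lemma R_schur (g : GL W) :
    (forall t w, g (A t w) = A t (g w)) -> (forall t w, g (B t w) = B t (g w)) ->
  exists c : F, forall w, g w = c *: w.
Proof.
move=> gA gB; pose c xi : F := g (basis_vec xi) xi.
have gc xi : g (basis_vec xi) = c xi *: basis_vec xi.
  apply/ffunP => eta; rewrite !ffunE; case: (eqVneq eta xi) => [->|neq].
    by rewrite [RHS]mulr1.
  have [t /negPf neq_t] : exists t, eta t != xi t.
    apply/existsP; apply: contraNT neq; rewrite negb_exists => /forallP eq_t.
    by apply/eqP/ffunP => t; apply/eqP; have := eq_t t; rewrite negbK.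
  have /(congr1 (fun w : W => w eta)) := gA t (basis_vec xi).
  rewrite glA_basis GLZ W_scaleE A_apply.
  move=> /eqP; rewrite -subr_eq0 -mulrBl mulf_eq0 subr_eq0 => /orP[|/eqP->].
    by rewrite (inj_eq chi_inj) eq_sym neq_t.
  by rewrite [RHS]mulr0.
have c_const : forall xi, c xi = c label0.
  apply: label_spread => xi t; rewrite -ordSE.
  have := gB t (basis_vec xi); rewrite glB_basis !gc linearZ /= glB_basis.
  move=> /(congr1 (fun w : W => w (replace xi t (ordS (xi t))))).
  by rewrite !ffunE eqxx ![_ *: 1]mulr1.
exists (c label0) => w.
rewrite [in LHS](basis_sum w) [in RHS](basis_sum w) linear_sum scaler_sumr.
by apply: eq_bigr => xi _; rewrite linearZ /= gc c_const !scalerA mulrC.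
Qed.

Lemma G_superdet g : g \in G -> commP g /\ sdet g = 1.
Proof.
have sdet1 : sdet (\1%VF : 'End(W)) = 1.
  by rewrite -[X in sdet X]scale1r sdet_scalar ?oner_neq0.
move: g; apply: generated_ind.
- move=> g /or3P[/existsP[t /eqP->]||/existsP[t /eqP->]].
  + split; last exact: sdet_lambdaC.
    by move=> w; rewrite !scale_lfunE opC_comm linearZ.
  + case/existsP => s /existsP[t /andP[_ /eqP->]].
    by split; [apply: opD_comm | apply: sdet_opD].
  by split; [apply: opU_comm | apply: sdet_opU].
- by split => // w; rewrite !GL1.
- move=> g h [gP g1] [hP h1]; split; first exact: commP_comp.
  by rewrite [LHS]sdet_comp // g1 h1 mulr1.
move=> g [gP g1].
have VP : commP (g^-1)%g.
  by move=> w; apply: (lker0P (GL_lker0 g)); rewrite gP !GLK.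
split=> //; have := sdet_comp gP VP; rewrite g1 mul1r => <-.
rewrite -sdet1; congr sdet; exact: (congr1 (@GL_lfun _ _) (mulgV g)).
Qed.

Lemma A_expr t : (A t ^+ r = 1)%g.
Proof.
apply/GLP => w; rewrite GL1 -[w in RHS]GL1; apply: GL_basisP w => xi; rewrite GL1.
have E n : (A t ^+ n)%g (basis_vec xi) = chi (xi t) ^+ n *: basis_vec xi.
  elim: n => [|n IHn]; first by rewrite GL1 scale1r.
  by rewrite expgS GLM IHn GLZ glA_basis scalerA exprS mulrC.
by rewrite E -exprM mulnC exprM (prim_expr_order theta_prim) expr1n scale1r.
Qed.

Lemma B_expr t : (B t ^+ r = 1)%g.
Proof.
apply/GLP => w; rewrite GL1 -[w in RHS]GL1; apply: GL_basisP w => xi; rewrite GL1.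
have E n : (B t ^+ n)%g (basis_vec xi) = basis_vec (replace xi t (xi t + n%:R)).
  elim: n => [|n IHn]; first by rewrite GL1 addr0 replace_id.
  by rewrite expgS GLM IHn glB_basis replaceE replace_replace ordSE -addrA natr1.
have r0 : r%:R = 0 :> 'I_r by rewrite Zp_nat; apply/val_inj; rewrite /= modnn.
by rewrite E r0 addr0 replace_id.
Qed.

Lemma PK w : opP (opP w) = w.
Proof. by apply/ffunP => eta; rewrite !opPE neg_labelK. Qed.

Lemma P_A t w : A t (opP (A t w)) = opP w.
Proof.
apply/ffunP => eta; rewrite A_apply !opPE A_apply ffunE mulrA -chiD.
by rewrite subrr chi0 mul1r.
Qed.

Lemma P_B t w : B t (opP (B t w)) = opP w.
Proof.
rewrite -[in RHS](GL1 w) -[B t (opP _)]comp_lfunE.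
rewrite -[X in X = _]comp_lfunE -[RHS]comp_lfunE.
apply: basisP w => xi; rewrite !comp_lfunE GL1.
rewrite glB_basis !endoE; congr basis_vec; apply/ffunP => s; rewrite !ffunE ordSE.
by case: eqVneq => [->|//]; rewrite eqxx ordSE opprD addrNK.
Qed.

(** Conjugation by the parity inverts x, so it turns the scalar c into its
    inverse; as c ^ r = 1 with r odd, c = 1. *)
Lemma parity_commute (g x : GL W) c :
    commP g -> (x ^+ r = 1)%g -> (forall w, x (opP (x w)) = opP w) ->
    (forall w, g (x w) = c *: x (g w)) ->
  forall w, g (x w) = x (g w).
Proof.
move=> gP xr xP gx.
have [w0 w0_neq0] := W_neq0 l theta_prim.
have gw0 : g w0 != 0.
  apply: contra w0_neq0 => /eqP E; apply/eqP/(lker0P (GL_lker0 g)).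
  by rewrite E linear0.
have c1 d : d *: g w0 = g w0 -> d = 1.
  move=> /eqP; rewrite -subr_eq0 -{2}[g w0]scale1r -scalerBl scaler_eq0 (negPf gw0).
  by rewrite orbF subr_eq0 => /eqP.
have cr : c ^+ r = 1.
  have E n w : g ((x ^+ n)%g w) = c ^+ n *: (x ^+ n)%g (g w).
    elim: n => [|n IHn] in w *; first by rewrite !GL1 scale1r.
    by rewrite expgS !GLM gx IHn GLZ scalerA exprS.
  by apply: c1; have := E r w0; rewrite xr !GL1 => <-.
have c2 : c ^+ 2 = 1.
  have PZ k v : opP (k *: v) = k *: opP v by rewrite linearZ.
  apply: c1; have := gx (opP (x (opP w0))).
  by rewrite xP PK gP gx PZ GLZ xP gP PK scalerA -expr2 => <-.
have c_1 : c = 1.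
  have rE : r = (2 * r./2).+1 by move: r_odd; clear; lia.
  by move: cr; rewrite rE exprS exprM c2 expr1n mulr1.
by move=> w; rewrite gx c_1 scale1r.
Qed.

(** The quotient of y by x is central in R, hence a scalar by Schur's lemma. *)
Lemma coset_eq_scalar (x y : Rt) : cl x = cl y ->
  exists c : F, forall w, (val y : GL W) w = c *: (val x : GL W) w.
Proof.
have -> : (cl x = cl y) <-> same_coset x y by split => /eqmodP.
move/centreP => cen.
have comm (z : Rt) w : (val x^-1 * val y)%g ((val z : GL W) w) =
    (val z : GL W) ((val x^-1 * val y : GL W)%g w).
  by rewrite -!GLM; congr (GL_lfun _ w); have /(congr1 val) := cen z.
have [c cE] := R_schur (fun t => comm (rA t))
                       (fun t => comm (rB t)).
by exists c => w; rewrite -linearZ /= -cE -GLM mulgA mulgV mul1g.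
Qed.

(** Such a g commutes with R up to scalars, hence commutes with R, hence is a
    scalar c; and c is its superdeterminant, which is 1. *)
Lemma pi_Sp_ker (g : subg_type (normR)) :
  val g \in G -> val (pi_Sp r_prime g) = 1%g -> val g = 1%g.
Proof.
move=> /G_superdet[gP g1] pi1.
have comm (x : Rt) : exists c, forall w,
    (val g : GL W) ((val x : GL W) w) = c *: (val x : GL W) ((val g : GL W) w).
  have : cl x = cl (conj_R g x) by rewrite -pi_Sp_cl pi1 GL1.
  case/coset_eq_scalar => c cE; exists c => w.
  by rewrite -cE SubK !GLM GLVK.
have [|t w|c cE] := @R_schur (val g).
- move=> t; have [c cE] := comm (rA t).
  exact: (parity_commute gP (A_expr t) (P_A t) cE).
- have [c cE] := comm (rB t).
  exact: (parity_commute gP (B_expr t) (P_B t) cE).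
have [w0 w0_neq0] := W_neq0 l theta_prim.
have c0 : c != 0.
  apply: contra w0_neq0 => /eqP E; apply/eqP/(lker0P (GL_lker0 (val g))).
  by rewrite cE E scale0r linear0.
have gE : GL_lfun (val g) = c *: \1%VF.
  by apply/lfunP => w; rewrite cE scale_lfunE id_lfunE.
have c1 : c = 1 by rewrite -g1 gE sdet_scalar.
by apply/GLP => w; rewrite cE c1 scale1r GL1.
Qed.

Definition G_to_norm (g : subg_type (G)) : subg_type (normR) :=
  Sub (val g) (G_normR (valP g)).

Definition G_to_Sp g := pi_Sp r_prime (G_to_norm g).

Fact G_to_Sp_mulg : {morph G_to_Sp : g h / (g * h)%g}.
Proof.
by move=> g h; rewrite -pi_Sp_mulg; congr pi_Sp; apply/val_inj.
Qed.

HB.instance Definition _ :=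
  isMultiplicative.Build (subg_type (G))
    (subg_type (Sp l r_prime theta_prim)) G_to_Sp G_to_Sp_mulg.

Lemma G_to_Sp1 : G_to_Sp 1%g = 1%g.
Proof. by apply: (mulgI (G_to_Sp 1%g)); rewrite -G_to_Sp_mulg !mulg1. Qed.

Lemma G_to_SpV g : G_to_Sp g^-1%g = (G_to_Sp g)^-1%g.
Proof.
by apply: (mulgI (G_to_Sp g)); rewrite -G_to_Sp_mulg !mulgV G_to_Sp1.
Qed.

Lemma G_to_Sp_inj : injective G_to_Sp.
Proof.
move=> g h gh; pose x := (g^-1 * h)%g.
have x1 : G_to_Sp x = 1%g by rewrite G_to_Sp_mulg G_to_SpV gh mulVg.
have /= E := @pi_Sp_ker (G_to_norm x) (valP x) (congr1 val x1).
apply/val_inj/esym/(mulgI (val g)^-1%g); rewrite mulVg; exact: E.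
Qed.

Definition image_G : {pred GL Q} :=
  fun h => `[< exists g, val (G_to_Sp g) = h >].

Fact image_G_mulg : mulg_closed image_G.
Proof.
move=> _ _ /asboolP[g <-] /asboolP[h <-]; apply/asboolP; exists (g * h)%g.
by rewrite G_to_Sp_mulg.
Qed.

Fact image_G_one : 1%g \in image_G.
Proof. by apply/asboolP; exists 1%g; rewrite G_to_Sp1. Qed.

Fact image_G_invg : invg_closed image_G.
Proof.
move=> _ /asboolP[g <-]; apply/asboolP; exists (g^-1)%g.
by rewrite G_to_SpV.
Qed.

(** * Surjectivity *)

HB.instance Definition _ := isMulClosed.Build (GL Q) image_G
  image_G_mulg.
HB.instance Definition _ := isMul1Closed.Build (GL Q) image_G
  image_G_one.
HB.instance Definition _ := isInvClosed.Build (GL Q) image_G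
  image_G_invg.

Lemma image_G_iso : {subset image_G <= isometries form}.
Proof. by move=> _ /asboolP[g <-]; apply: valP. Qed.

Lemma C_in_G t : C t \in G.
Proof. by apply: mem_generated; apply/or3P/Or31/existsP; exists t. Qed.
Lemma D_in_G s t : (s < t)%N -> D s t \in G.
Proof.
move=> st; apply: mem_generated; apply/or3P/Or32/existsP; exists s.
by apply/existsP; exists t; rewrite st eqxx.
Qed.
Lemma U_in_G t : U t \in G.
Proof. by apply: mem_generated; apply/or3P/Or33/existsP; exists t. Qed.

Lemma to_Sp_eq (g : subg_type G) (x y : Rt) (c : F) :
    (forall w, (val g : GL W) ((val x : GL W) w) =
               c *: (val y : GL W) ((val g : GL W) w)) ->
  val (G_to_Sp g) (cl x) = cl y.
Proof. exact: (@pi_Sp_eq (G_to_norm g)). Qed.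

Lemma to_Sp_eq1 (g : subg_type G) (x y : Rt) :
    (forall w, (val g : GL W) ((val x : GL W) w) =
               (val y : GL W) ((val g : GL W) w)) ->
  val (G_to_Sp g) (cl x) = cl y.
Proof. by move=> E; apply: (@to_Sp_eq _ _ _ 1) => w; rewrite scale1r. Qed.

Lemma form_ba s t : form (b s) (a t) = - (s == t)%:R.
Proof. by rewrite comm_formN (comm_form_AB r_prime) eq_sym. Qed.

Lemma image_C t : exists2 h : GL Q, h \in image_G & h (a t) = - b t.
Proof.
pose g : subg_type G := Sub (C t) (C_in_G t).
exists (val (G_to_Sp g)); first by apply/asboolP; exists g.
have -> : - b t = cl (rB t)^-1%g.
  by apply/eqP; rewrite eq_sym -subr_eq0 opprK -clM mulVg; apply/eqP.
apply: to_Sp_eq1 => w; apply: (lker0P (GL_lker0 (B t))).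
by rewrite GLK; apply: C_A.
Qed.

Local Notation T := (transvection (@comm_formDl F r l theta r_prime theta_prim)
  (@comm_formZl F r l theta r_prime theta_prim)
  (@comm_form_alt F r l theta r_prime theta_prim)).

Lemma GL_linear (g : GL Q) : linear g.
Proof. exact: linearP. Qed.

Lemma image_U t : T (-1) (a t) \in image_G.
Proof.
pose g : subg_type G := Sub (U t) (U_in_G t).
apply/asboolP; exists g; apply/GLP; apply: Q_ext; try exact: GL_linear.
  move=> s; rewrite transvectionE (comm_form_AA r_prime) mulr0 scale0r addr0.
  by apply: to_Sp_eq1 => w; apply: U_A.
move=> s; rewrite transvectionE form_ba mulrNN mul1r.
have [->|st] := eqVneq s t; last first.
  rewrite scale0r addr0; apply: to_Sp_eq1 => w; apply: U_B_neq => //.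
  by rewrite eq_sym.
rewrite scale1r -clM; apply: (@to_Sp_eq _ _ _ (chi half_Zp)) => w.
by rewrite [RHS](congr1 _ (GLM _ _ _)); apply: U_B.
Qed.

(** The field of r elements is prime, so the powers of one transvection form the
    whole root subgroup. *)
Lemma image_root k t : T k (a t) \in image_G.
Proof.
rewrite (_ : T k (a t) = (T (-1) (a t) ^+ (- k)%R)%g); first exact/gpredXn/image_U.
by rewrite transvectionX natr_Zp mulrN1 opprK.
Qed.

Lemma image_D s t : (s < t)%N -> exists2 h : GL Q, h \in image_G &
  forall v, h v = v - form v (a t) *: a s - form v (a s) *: a t.
Proof.
move=> lt_st; have st : s != t by rewrite -val_eqE neq_ltn lt_st.
pose g : subg_type G := Sub (D s t) (D_in_G lt_st).
exists (val (G_to_Sp g)); first by apply/asboolP; exists g.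
apply: Q_ext; first exact: GL_linear.
- move=> k u v; rewrite !comm_formDl !comm_formZl !scalerDl -!scalerA !scalerBr.
  by rewrite !opprD [k *: u + v + _]addrACA; apply: addrACA.
- move=> u; rewrite !(comm_form_AA r_prime) !scale0r !subr0.
  by apply: to_Sp_eq1 => w; apply: D_A.
move=> u; rewrite !form_ba !scaleNr !opprK.
have [->|us] := eqVneq u s.
  rewrite (negPf st) scale0r addr0 scale1r -clM; apply: to_Sp_eq1 => w.
  by rewrite [RHS]GLM; apply: D_Bl.
rewrite scale0r addr0.
have [->|ut] := eqVneq u t.
  rewrite scale1r -clM; apply: to_Sp_eq1 => w.
  by rewrite [RHS]GLM; apply: D_Br.
by rewrite scale0r addr0; apply: to_Sp_eq1 => w; apply: D_B_neq.
Qed.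

Lemma form_separates (v : Q) :
  (forall t, form v (a t) = 0) -> (forall t, form v (b t) = 0) -> v = 0.
Proof.
move=> va vb; apply: coords_inj; congr row_mx; apply/rowP => t; rewrite !mxE.
  by rewrite vb -[0 in RHS](scale0r (0 : Q)) comm_formZl mul0r.
by rewrite va -[0 in RHS](scale0r (0 : Q)) comm_formZl mul0r.
Qed.

Lemma G_to_Sp_surj h : exists g, G_to_Sp g = h.
Proof.
have : val h \in image_G.
  apply: (isometries_generated _ image_G_iso _ _ _ form_separates image_root
    image_C image_D) (valP h).
  - exact: comm_formN.
  - exact: comm_form_AB.
  - exact: comm_form_AA.
  - exact: comm_form_BB.
by case/asboolP => g gh; exists g; apply/val_inj.
Qed.

Lemma G_to_Sp_bij : bijective G_to_Sp.
Proof.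
have [inv invK] := choice G_to_Sp_surj.
by exists inv => // g; apply: G_to_Sp_inj.
Qed.

End WeilRepresentation.

Theorem theorem1p3 (r l : nat) (F : fieldType) (theta : F)
    (r_prime : prime r) (r_odd : odd r) (l_gt0 : (0 < l)%N)
    (theta_prim : r.-primitive_root theta) :
  {subset G l theta_prim <= normR l theta_prim} /\
  exists f : {multiplicative subg_type (G l theta_prim) ->
                subg_type (Sp l r_prime theta_prim)},
    bijective f /\
    forall (g : subg_type (G l theta_prim)) (h : subg_type (normR l theta_prim)),
      val g = val h -> f g = pi_Sp r_prime h.
Proof.
case: r r_prime r_odd theta_prim => [|[|m]] // r_prime r_odd theta_prim.
split; first by move=> g; apply: G_normR.
exists (@G_to_Sp F m theta r_odd theta_prim l r_prime l_gt0).
split; first exact: G_to_Sp_bij.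
by move=> g h gh; congr (pi_Sp r_prime _); apply/val_inj.
Qed.
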